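(* Let $k$ be a perfect field of characteristic $p>2$, and let $m$ and $n$ be positive integers. Then $\mathrm{Ext}_{GL(m|n)}^2(k,k)\neq0$.
   Context: $GL(m|n)$ is the general linear supergroup over $k$: the affine $k$-supergroup scheme sending a commutative $k$-superalgebra $A=A_{\bar0}\oplus A_{\bar1}$ to the group of invertible $(m+n)\times(m+n)$ block matrices whose diagonal blocks (of sizes $m\times m$ and $n\times n$) have entries in $A_{\bar0}$ and whose off-diagonal blocks have entries in $A_{\bar1}$. A rational $GL(m|n)$-supermodule is a supercomodule over the coordinate Hopf superalgebra $k[GL(m|n)]$. $\mathrm{Ext}^i_{GL(m|n)}(k,-)$ is the $i$-th right derived functor of $\mathrm{Hom}_{GL(m|n)}(k,-)$ (all homomorphisms, even and odd) from the abelian category of rational $GL(m|n)$-supermodules with even homomorphisms to superspaces; $k$ is the trivial supermodule. *)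

(* Defs.v *)
From HB Require Import structures.
From mathcomp Require Import all_boot all_algebra all_field.
From mathcomp Require Import generic_quotient boolp.
Set Implicit Arguments.
Unset Strict Implicit.
Unset Printing Implicit Defensive.
Import GRing.Theory.
Local Open Scope ring_scope.
Local Open Scope quotient_scope.

Section Tensor.
Variables (k : fieldType) (V W : lmodType k).

Definition bilin (U : lmodType k) (b : V -> W -> U) :=
  (forall v, linear (b v)) /\ (forall w, linear (b^~ w)).

Definition tsum (U : nmodType) (b : V -> W -> U) (s : seq (V * W)) : U :=
  \sum_(p <- s) b p.1 p.2.

(* Finite formal sums of pairs, identified when no bilinear map separates them:
   the quotient is the tensor product. *)
Definition teq : rel (seq (V * W)) := fun s t =>
  `[< forall (U : lmodType k) (b : V -> W -> U), bilin b ->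
      tsum b s = tsum b t >].

Lemma teq_refl : reflexive teq.
Proof. by move=> s; apply/asboolP. Qed.
Lemma teq_sym : symmetric teq.
Proof.
by move=> s t; apply/asboolP/asboolP => h U b hb; rewrite (h U b hb).
Qed.
Lemma teq_trans : transitive teq.
Proof.
move=> t s u /asboolP h /asboolP h'; apply/asboolP => U b hb.
by rewrite (h U b hb) (h' U b hb).
Qed.
Canonical teq_equiv := EquivRel teq teq_refl teq_sym teq_trans.

Definition tens := {eq_quot teq}.
HB.instance Definition _ : EqQuotient _ teq tens := EqQuotient.on tens.
HB.instance Definition _ := Choice.on tens.

(* The map out of the tensor product induced by b; only meaningful for bilinear
   b, see tlift_linear and tlift_pure. *)
Definition tlift (U : nmodType) (b : V -> W -> U) (x : tens) : U :=
  tsum b (repr x).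

Lemma tlift_pi (U : lmodType k) (b : V -> W -> U) s :
  bilin b -> tlift b (\pi_tens s) = tsum b s.
Proof.
move=> hb; rewrite /tlift.
have : teq (repr (\pi_tens s)) s by apply/eqmodP; rewrite reprK.
by move/asboolP; apply.
Qed.

Lemma tens_ext (x y : tens) :
  (forall (U : lmodType k) (b : V -> W -> U), bilin b -> tlift b x = tlift b y)
  -> x = y.
Proof.
elim/quotW: x => s; elim/quotW: y => t h.
apply/eqmodP/asboolP => U b hb; by rewrite -!tlift_pi // h.
Qed.

Definition t0 : tens := \pi_tens [::].
Definition tadd (x y : tens) : tens := \pi_tens (repr x ++ repr y).
Definition tscale (a : k) (x : tens) : tens :=
  \pi_tens [seq (a *: p.1, p.2) | p <- repr x].
Definition topp (x : tens) : tens := tscale (-1) x.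

Section Lift.
Variables (U : lmodType k) (b : V -> W -> U) (hb : bilin b).
Lemma tlift_0 : tlift b t0 = 0.
Proof. by rewrite tlift_pi // /tsum big_nil. Qed.
Lemma tlift_add x y : tlift b (tadd x y) = tlift b x + tlift b y.
Proof. by rewrite tlift_pi // /tsum big_cat. Qed.
Lemma tlift_scale a x : tlift b (tscale a x) = a *: tlift b x.
Proof.
rewrite tlift_pi // /tsum big_map /tlift scaler_sumr; apply: eq_bigr => p _ /=.
have := hb.2 p.2 a p.1 0; rewrite addr0 /= => ->.
have := hb.2 p.2 (-1) 0 0; rewrite scaler0 addr0 /= scaleN1r addNr => ->.
by rewrite addr0.
Qed.
Lemma tlift_opp x : tlift b (topp x) = - tlift b x.
Proof. by rewrite tlift_scale scaleN1r. Qed.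
End Lift.

Local Ltac tens := move=> *; apply: tens_ext => ? ? ?;
  rewrite ?(tlift_add, tlift_opp, tlift_scale, tlift_0) //.

Lemma taddA : associative tadd. Proof. by tens; rewrite addrA. Qed.
Lemma taddC : commutative tadd. Proof. by tens; rewrite addrC. Qed.
Lemma tadd0 : left_id t0 tadd. Proof. by tens; rewrite add0r. Qed.
Lemma taddN : left_inverse t0 topp tadd. Proof. by tens; rewrite addNr. Qed.
HB.instance Definition _ := GRing.isZmodule.Build tens taddA taddC tadd0 taddN.

Lemma tscaleA a b x : tscale a (tscale b x) = tscale (a * b) x.
Proof. by tens; rewrite scalerA. Qed.
Lemma tscale1 : left_id 1 tscale. Proof. by tens; rewrite scale1r. Qed.
Lemma tscaleDr : right_distributive tscale +%R.
Proof. by tens; rewrite -scalerDr. Qed.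
Lemma tscaleDl x : {morph tscale^~ x : a b / a + b}.
Proof. by tens; rewrite scalerDl. Qed.
HB.instance Definition _ :=
  GRing.Zmodule_isLmodule.Build k tens tscaleA tscale1 tscaleDr tscaleDl.


Definition tpure (v : V) (w : W) : tens := \pi_tens [:: (v, w)].

Lemma tlift_linear (U : lmodType k) (b : V -> W -> U) :
  bilin b -> linear (tlift b).
Proof. by move=> hb a x y; rewrite tlift_add // tlift_scale. Qed.

Lemma tlift_pure (U : lmodType k) (b : V -> W -> U) v w :
  bilin b -> tlift b (tpure v w) = b v w.
Proof. by move=> hb; rewrite tlift_pi // /tsum big_seq1. Qed.

Lemma bilin_pure : bilin tpure.
Proof.
by split=> [v a w w'|w a v v']; apply: tens_ext => U b hb;
  rewrite tlift_linear // !tlift_pure //; [apply: hb.1 | apply: hb.2].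
Qed.

Lemma tens_sum (x : tens) : x = \sum_(p <- repr x) tpure p.1 p.2.
Proof.
apply: tens_ext => U b hb.
have sumE (r : seq (V * W)) : tlift b (\sum_(p <- r) tpure p.1 p.2) = tsum b r.
  elim: r => [|p r ih]; first by rewrite /tsum !big_nil tlift_0.
  by rewrite /tsum !big_cons tlift_add // tlift_pure // ih.
by rewrite sumE.
Qed.

Lemma tens_ind (P : tens -> Prop) :
  P 0 -> (forall x y, P x -> P y -> P (x + y)) -> (forall v w, P (tpure v w)) ->
  forall x, P x.
Proof. by move=> P0 PD Pp x; rewrite (tens_sum x); apply: big_ind => // p _. Qed.

End Tensor.

Notation "v \tp w" := (tpure v w) (at level 40, left associativity).

Section Superspaces.
Variable k : fieldType.

(* A Z/2-grading is encoded by the projection ev onto the even part along the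
   odd part. *)
Record superspace := Superspace {
  sv :> lmodType k;
  ev : {linear sv -> sv};
  evK : forall v, ev (ev v) = ev v }.

Definition homog (V : lmodType k) (e : V -> V) (b : bool) (v : V) : Prop :=
  e v = if b then 0 else v.

Definition part (V : lmodType k) (e : V -> V) (b : bool) (v : V) : V :=
  if b then v - e v else e v.

(* Supercommutative superalgebras. *)
Record csalg := Csalg {
  calg :> algType k;
  cev : {linear calg -> calg};
  cevK : forall x, cev (cev x) = cev x;
  cev1 : homog cev false 1;
  cevM : forall b c x y, homog cev b x -> homog cev c y ->
    homog cev (b (+) c) (x * y);
  cevC : forall b c x y, homog cev b x -> homog cev c y ->
    x * y = (-1) ^+ (b && c) * (y * x) }.

Definition csalg_superspace (A : csalg) : superspace := Superspace (@cevK A).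

End Superspaces.

Arguments part : simpl never.

Section TensorSuperspace.
Variable k : fieldType.

Lemma partD (V : lmodType k) (e : V -> V) v : v = part e false v + part e true v.
Proof. by rewrite /part addrC subrK. Qed.

Lemma part_linear (V : lmodType k) (e : {linear V -> V}) b : linear (part e b).
Proof.
by case: b => a u v; rewrite /part linearP // scalerBr opprD addrACA.
Qed.

Lemma part_homog (V : lmodType k) (e : {linear V -> V}) b v :
  (forall v, e (e v) = e v) -> homog e b (part e b v).
Proof. by case: b => eK; rewrite /homog /part ?linearB /= ?eK ?subrr. Qed.

Lemma part_id (V : lmodType k) (e : V -> V) b v :
  homog e b v -> forall c, part e c v = if b == c then v else 0.
Proof. by rewrite /homog /part => -> []; case: b; rewrite ?subr0 ?subrr. Qed.

Section S.
Variables (V W : lmodType k) (e : {linear V -> V}) (f : {linear W -> W}).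
Hypotheses (eK : forall v, e (e v) = e v) (fK : forall v, f (f v) = f v).

Definition tev : tens V W -> tens V W :=
  tlift (fun v w => part e false v \tp part f false w
                    + part e true v \tp part f true w).

Lemma bilinD (U : lmodType k) (b b' : V -> W -> U) :
  bilin b -> bilin b' -> bilin (fun v w => b v w + b' v w).
Proof.
move=> [h1 h2] [h1' h2']; split=> [v a w w'|w a v v'] /=.
  by rewrite h1 h1' scalerDr addrACA.
by have /= -> := h2 w a v v'; have /= -> := h2' w a v v'; rewrite scalerDr addrACA.
Qed.

Lemma bilin_comp (V' W' U : lmodType k) (b : V' -> W' -> U) (g : V -> V')
   (h : W -> W') : linear g -> linear h -> bilin b ->
   bilin (fun v w => b (g v) (h w)).
Proof.
move=> lg lh [h1 h2]; split=> [v a w w'|w a v v'] /=; first by rewrite lh h1.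
by rewrite lg; apply: h2.
Qed.

Lemma bilin_tev : bilin (fun v w => part e false v \tp part f false w
                    + part e true v \tp part f true w).
Proof.
by apply: bilinD; apply: bilin_comp; try apply: part_linear; apply: bilin_pure.
Qed.

Lemma tev_linear : linear tev. Proof. exact: tlift_linear bilin_tev. Qed.
HB.instance Definition _ := GRing.isLinear.Build k (tens V W) (tens V W) _ tev tev_linear.

Lemma tpure0l (w : W) : (0 : V) \tp w = 0.
Proof.
have /= := (bilin_pure V W).2 w (-1) 0 0.
by rewrite scaler0 addr0 scaleN1r addNr.
Qed.
Lemma tpure0r (v : V) : v \tp (0 : W) = 0.
Proof.
have /= := (bilin_pure V W).1 v (-1) 0 0.
by rewrite scaler0 addr0 scaleN1r addNr.
Qed.
Lemma tpureDl (u v : V) (w : W) : (u + v : V) \tp w = u \tp w + v \tp w.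
Proof. by have /= := (bilin_pure V W).2 w 1 u v; rewrite !scale1r. Qed.
Lemma tpureDr (v : V) (u w : W) : v \tp (u + w : W) = v \tp u + v \tp w.
Proof. by have /= := (bilin_pure V W).1 v 1 u w; rewrite !scale1r. Qed.
Lemma tpureZl a (v : V) (w : W) : (a *: v : V) \tp w = a *: (v \tp w).
Proof. by have /= := (bilin_pure V W).2 w a v 0; rewrite tpure0l !addr0. Qed.
Lemma tpureZr a (v : V) (w : W) : v \tp (a *: w : W) = a *: (v \tp w).
Proof. by have /= := (bilin_pure V W).1 v a w 0; rewrite tpure0r !addr0. Qed.

Lemma tev_pure b c v w :
  homog e b v -> homog f c w -> homog tev (b (+) c) (v \tp w).
Proof.
move=> hv hw; rewrite /homog /tev tlift_pure; last exact: bilin_tev.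
rewrite !(part_id hv) !(part_id hw).
by case: b hv; case: c hw => _ _ /=; rewrite ?tpure0l ?tpure0r ?addr0 ?add0r.
Qed.

Lemma tens_homog_ind (P : tens V W -> Prop) :
  P 0 -> (forall x y, P x -> P y -> P (x + y)) ->
  (forall b c v w, homog e b v -> homog f c w -> P (v \tp w)) ->
  forall x, P x.
Proof.
move=> P0 PD Pp; apply: tens_ind => // v w.
have H b c : P (part e b v \tp part f c w).
  by apply: (Pp b c); exact: part_homog.
rewrite (partD e v) tpureDl (partD f w) !(tpureDr _ (part f false w)).
exact: PD (PD _ _ (H _ _) (H _ _)) (PD _ _ (H _ _) (H _ _)).
Qed.

Lemma tevK x : tev (tev x) = tev x.
Proof.
elim/tens_homog_ind: x => [|x y hx hy|b c v w hv hw]; first by rewrite !linear0.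
  by rewrite !linearD /= hx hy.
by have := tev_pure hv hw; rewrite /homog => ->; case: ifP => h;
  rewrite ?linear0 // (tev_pure hv hw) h.
Qed.
End S.

Definition tens_superspace (V W : superspace k) : superspace k :=
  @Superspace k (tens V W) (tev (ev V) (ev W)) (tevK (@evK k V) (@evK k W)).

End TensorSuperspace.

Section TensorAlgebra.
Variables (k : fieldType) (A B : csalg k).
Local Notation eA := (@cev k A).
Local Notation eB := (@cev k B).

(* Extends bilinearly the rule (a (x) b)(c (x) d) = (-1)^(|b||c|) ac (x) bd
   for homogeneous b and c. *)
Definition tmul (x y : tens A B) : tens A B :=
  tlift (fun a b => tlift (fun c d =>
      (a * c) \tp (part eB false b * d)
    + (a * (part eA false c - part eA true c)) \tp (part eB true b * d)) y) x.

Lemma bilin_tmul_in a b : bilin (fun c d => (a * c) \tp (part eB false b * d)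
    + (a * (part eA false c - part eA true c)) \tp (part eB true b * d)).
Proof.
apply: bilinD; apply: (bilin_comp _ _ (bilin_pure A B)) => s u v /=.
- by rewrite mulrDr -scalerAr.
- by rewrite mulrDr -scalerAr.
- rewrite scalerAr -mulrDr; congr (_ * _).
  by rewrite !part_linear opprD addrACA -scalerBr.
- by rewrite mulrDr -scalerAr.
Qed.

Lemma bilin_tmul_out y : bilin (fun a b => tlift (fun c d =>
      (a * c) \tp (part eB false b * d)
    + (a * (part eA false c - part eA true c)) \tp (part eB true b * d)) y).
Proof.
split=> [a s b b'|b s a a']; rewrite /tlift /tsum scaler_sumr -big_split /=;
  apply: eq_bigr => -[c d] _ /=.
- have := part_linear eB true; have := part_linear eB false.
  move: (part eB false) (part eB true) (_ - _) => p0 p1 c' l0 l1.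
  by rewrite l0 l1 !mulrDl -!scalerAl !tpureDr !tpureZr scalerDr addrACA.
- move: (part eB false b) (part eB true b) (_ - _) => b0 b1 c'.
  by rewrite !mulrDl -!scalerAl !tpureDl !tpureZl scalerDr addrACA.
Qed.

Lemma tmul_linl s x x' y : tmul (s *: x + x') y = s *: tmul x y + tmul x' y.
Proof. exact: (tlift_linear (bilin_tmul_out y)). Qed.

Lemma tmul_linr s x y y' : tmul x (s *: y + y') = s *: tmul x y + tmul x y'.
Proof.
rewrite /tmul [in LHS]/tlift /tsum scaler_sumr -big_split /=.
by apply: eq_bigr => -[a b] _ /=; apply: (tlift_linear (bilin_tmul_in a b)).
Qed.

Lemma tmulDl x x' y : tmul (x + x') y = tmul x y + tmul x' y.
Proof. by have := tmul_linl 1 x x' y; rewrite !scale1r. Qed.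
Lemma tmulDr x y y' : tmul x (y + y') = tmul x y + tmul x y'.
Proof. by have := tmul_linr 1 x y y'; rewrite !scale1r. Qed.
Lemma tmul0l y : tmul 0 y = 0.
Proof. by apply: (addrI (tmul 0 y)); rewrite -tmulDl !addr0. Qed.
Lemma tmul0r y : tmul y 0 = 0.
Proof. by apply: (addrI (tmul y 0)); rewrite -tmulDr !addr0. Qed.
Lemma tmulZl s x y : tmul (s *: x) y = s *: tmul x y.
Proof. by have := tmul_linl s x 0 y; rewrite tmul0l !addr0. Qed.
Lemma tmulZr s x y : tmul x (s *: y) = s *: tmul x y.
Proof. by have := tmul_linr s x y 0; rewrite tmul0r !addr0. Qed.

Lemma tmul_pure q r (a : A) (b : B) (c : A) (d : B) :
  homog eB q b -> homog eA r c ->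
  tmul (a \tp b) (c \tp d) = (-1) ^+ (q && r) *: ((a * c) \tp (b * d)).
Proof.
move=> hb hc; rewrite /tmul tlift_pure; last exact: bilin_tmul_out.
rewrite tlift_pure; last exact: bilin_tmul_in.
rewrite !(part_id hb) !(part_id hc).
case: q hb; case: r hc => hc hb /=;
  rewrite ?mul0r ?tpure0r ?addr0 ?add0r ?subr0 ?expr0 ?expr1 ?scale1r //.
by rewrite mulrN -[- (a * c)]scaleN1r tpureZl.
Qed.

Definition tone : tens A B := 1 \tp 1.

Lemma tmul1l : left_id tone tmul.
Proof.
elim/(tens_homog_ind (@cevK k A) (@cevK k B)) => [|x y hx hy|q r c d hc hd].
- exact: tmul0r.
- by rewrite tmulDr hx hy.
- by rewrite (tmul_pure _ _ (cev1 B) hc) /= expr0 scale1r !mul1r.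
Qed.

Lemma tmul1r : right_id tone tmul.
Proof.
elim/(tens_homog_ind (@cevK k A) (@cevK k B)) => [|x y hx hy|q r c d hc hd].
- exact: tmul0l.
- by rewrite tmulDl hx hy.
- by rewrite (tmul_pure _ _ hd (cev1 A)) andbF expr0 scale1r !mulr1.
Qed.

Lemma tmulA : associative tmul.
Proof.
move=> x y z.
elim/(tens_homog_ind (@cevK k A) (@cevK k B)): x => [|x x' hx hx'|pa pb a b ha hb].
- by rewrite !tmul0l.
- by rewrite !tmulDl hx hx'.
elim/(tens_homog_ind (@cevK k A) (@cevK k B)): y => [|x x' hx hx'|pc pd c d hc hd].
- by rewrite tmul0l tmul0r tmul0l.
- by rewrite tmulDl !tmulDr tmulDl hx hx'.
elim/(tens_homog_ind (@cevK k A) (@cevK k B)): z => [|x x' hx hx'|pu pv u v hu hv].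
- by rewrite !tmul0r.
- by rewrite !tmulDr hx hx'.
rewrite (tmul_pure _ _ hd hu) (tmul_pure _ _ hb hc) tmulZl tmulZr.
rewrite (tmul_pure _ _ hb (cevM hc hu)) (tmul_pure _ _ (cevM hb hd) hu).
rewrite !scalerA !mulrA; congr (_ *: _).
by case: pb {hb}; case: pc {hc}; case: pd {hd}; case: pu {hu};
  rewrite /= ?expr0 ?expr1 ?mulr1 ?mul1r ?mulrN1 ?opprK.
Qed.

(* The tensor product of two superalgebras.  The unital algebras of the library
   are nonzero, hence the argument. *)
Definition talg (nz : tone != 0) : Type := tens A B.

Section Instances.
Variable nz : tone != 0.
HB.instance Definition _ := GRing.Lmodule.on (talg nz).
HB.instance Definition _ := GRing.Zmodule_isNzRing.Build (talg nz)
  tmulA tmul1l tmul1r tmulDl tmulDr nz.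
Lemma talg_scaleAl s (x y : talg nz) : s *: (x * y) = (s *: x) * y.
Proof. exact/esym/tmulZl. Qed.
Lemma talg_scaleAr s (x y : talg nz) : s *: (x * y) = x * (s *: y).
Proof. exact/esym/tmulZr. Qed.
HB.instance Definition _ := GRing.Lmodule_isLalgebra.Build k (talg nz) talg_scaleAl.
HB.instance Definition _ := GRing.Lalgebra_isAlgebra.Build k (talg nz) talg_scaleAr.

Definition talg_ev : talg nz -> talg nz := tev eA eB.
HB.instance Definition _ := GRing.Linear.copy talg_ev (tev eA eB).

Lemma talg_evK x : talg_ev (talg_ev x) = talg_ev x.
Proof. exact: (tevK (@cevK k A) (@cevK k B)). Qed.

Lemma talg_ev1 : homog talg_ev false 1.
Proof. exact: (tev_pure (cev1 A) (cev1 B)). Qed.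

Lemma talg_homog_ind (q r : bool) (P : talg nz -> talg nz -> Prop) :
  (forall y, P 0 y) -> (forall x, P x 0) ->
  (forall x x' y, P x y -> P x' y -> P (x + x') y) ->
  (forall x y y', P x y -> P x y' -> P x (y + y')) ->
  (forall pa pb pc pd (a : A) (b : B) (c : A) (d : B),
     homog eA pa a -> homog eB pb b -> homog eA pc c -> homog eB pd d ->
     pa (+) pb = q -> pc (+) pd = r -> P (a \tp b) (c \tp d)) ->
  forall x y, homog talg_ev q x -> homog talg_ev r y -> P x y.
Proof.
move=> P0l P0r PDl PDr Pp x y hx hy.
have := part_id hx q; rewrite eqxx => <-.
have := part_id hy r; rewrite eqxx => <- {hx hy}.
have pD (s : bool) : {morph part talg_ev s : u v / u + v}.
  by move=> u v; have := part_linear talg_ev s 1 u v; rewrite !scale1r.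
have p0 (s : bool) : part talg_ev s 0 = 0.
  by rewrite /part; case: s; rewrite linear0 ?subr0.
elim/(tens_homog_ind (@cevK k A) (@cevK k B)): x => [|x x' hx hx'|pa pb a b ha hb].
- by rewrite p0.
- by rewrite pD; apply: PDl.
rewrite (part_id (tev_pure ha hb)); case: eqP => // hq.
elim/(tens_homog_ind (@cevK k A) (@cevK k B)): y => [|y y' hy hy'|pc pd c d hc hd].
- by rewrite p0.
- by rewrite pD; apply: PDr.
rewrite (part_id (tev_pure hc hd)); case: eqP => // hr.
exact: (Pp pa pb pc pd).
Qed.

Lemma talg_evM q r x y : homog talg_ev q x -> homog talg_ev r y ->
  homog talg_ev (q (+) r) (x * y).
Proof.
have h0 s : homog talg_ev s 0 by rewrite /homog linear0 if_same.
have hD s (u v : talg nz) :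
    homog talg_ev s u -> homog talg_ev s v -> homog talg_ev s (u + v).
  by move=> hu hv; rewrite /homog linearD /= hu hv; case: s {hu hv}; rewrite ?addr0.
move: x y; apply: talg_homog_ind => [y|x|x x' y h h'|x y y' h h'|].
- by rewrite mul0r.
- by rewrite mulr0.
- by rewrite mulrDl; apply: hD.
- by rewrite mulrDr; apply: hD.
move=> pa pb pc pd a b c d ha hb hc hd <- <-.
rewrite [_ * _](tmul_pure _ _ hb hc) addbACA /homog linearZ /=.
rewrite [talg_ev _](tev_pure (cevM ha hc) (cevM hb hd)).
by case: ifP => _; rewrite ?scaler0.
Qed.

Lemma talg_evC q r x y : homog talg_ev q x -> homog talg_ev r y ->
  x * y = (-1) ^+ (q && r) * (y * x).
Proof.
move: x y; apply: talg_homog_ind => [y|x|x x' y h h'|x y y' h h'|].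
- by rewrite mulr0 !mul0r mulr0.
- by rewrite mul0r !mulr0.
- by rewrite mulrDl mulrDr mulrDr h h'.
- by rewrite mulrDr mulrDl mulrDr h h'.
move=> pa pb pc pd a b c d ha hb hc hd <- <-.
have E1 : (a \tp b : talg nz) * (c \tp d : talg nz) = _ := tmul_pure a d hb hc.
have E2 : (c \tp d : talg nz) * (a \tp b : talg nz) = _ := tmul_pure c b hd ha.
rewrite E1 E2 {E1 E2}.
rewrite (cevC ha hc) (cevC hb hd) !mulr_sign.
rewrite -![if _ then - _ else _]scaler_sign tpureZl tpureZr !scalerA.
congr (_ *: _); rewrite -!signr_addb; congr (_ ^+ _); congr nat_of_bool.
by case: pa {ha}; case: pb {hb}; case: pc {hc}; case: pd {hd}.
Qed.

Definition tens_csalg : csalg k :=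
  @Csalg k (talg nz) talg_ev talg_evK talg_ev1 talg_evM talg_evC.
End Instances.
End TensorAlgebra.

Section Morphisms.
Variable k : fieldType.

Record shom (A B : csalg k) := Shom {
  shf :> {lrmorphism A -> B};
  sh_ev : forall x, shf (cev A x) = cev B (shf x) }.

Lemma homog0 (V : lmodType k) (e : {linear V -> V}) b : homog e b 0.
Proof. by rewrite /homog linear0 if_same. Qed.

Lemma homogD (V : lmodType k) (e : {linear V -> V}) b u v :
  homog e b u -> homog e b v -> homog e b (u + v).
Proof. by move=> hu hv; rewrite /homog linearD /= hu hv; case: b {hu hv}; rewrite ?addr0. Qed.

Lemma homogZ (V : lmodType k) (e : {linear V -> V}) b s u :
  homog e b u -> homog e b (s *: u).
Proof. by move=> hu; rewrite /homog linearZ /= hu; case: b {hu}; rewrite ?scaler0. Qed.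

Lemma homog_shom (A B : csalg k) (f : shom A B) b x :
  homog (cev A) b x -> homog (cev B) b (f x).
Proof. by rewrite /homog -sh_ev => ->; case: b; rewrite ?linear0. Qed.

Definition ground_ev : k^o -> k^o := idfun.
HB.instance Definition _ := GRing.Linear.copy ground_ev (@idfun k^o).

Lemma ground_evK (x : k^o) : ground_ev (ground_ev x) = ground_ev x.
Proof. by []. Qed.
Lemma ground_ev1 : homog ground_ev false 1.
Proof. by []. Qed.
Lemma ground_evM b c (x y : k^o) : homog ground_ev b x -> homog ground_ev c y ->
  homog ground_ev (b (+) c) (x * y).
Proof.
rewrite /homog /ground_ev /=; case: b => [-> _|_]; first by rewrite mul0r if_same.
by case: c => [->|//]; rewrite mulr0.
Qed.
Lemma ground_evC b c (x y : k^o) : homog ground_ev b x -> homog ground_ev c y ->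
  x * y = (-1) ^+ (b && c) * (y * x).
Proof.
rewrite /homog /ground_ev /=; case: b => /=; last by rewrite expr0 mul1r mulrC.
by move=> -> _; rewrite mul0r !mulr0.
Qed.

Definition ground : csalg k := Csalg ground_evK ground_ev1 ground_evM ground_evC.

Section Inclusions.
Variables (A B : csalg k) (nz : tone A B != 0).
Local Notation AB := (tens_csalg nz).

Definition tinl (a : A) : AB := (a \tp 1 : talg nz).
Definition tinr (b : B) : AB := (1 \tp b : talg nz).

Lemma tinl_linear : linear tinl.
Proof. exact: ((bilin_pure A B).2 1). Qed.
Lemma tinr_linear : linear tinr.
Proof. exact: ((bilin_pure A B).1 1). Qed.
HB.instance Definition _ := GRing.isLinear.Build k A AB _ tinl tinl_linear.
HB.instance Definition _ := GRing.isLinear.Build k B AB _ tinr tinr_linear.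

Lemma tinl_monoid : monoid_morphism tinl.
Proof.
split=> // x y; have hy := partD (cev A) y.
have H b : tmul (x \tp 1) (part (cev A) b y \tp 1) = (x * part (cev A) b y) \tp (1 : B).
  rewrite (tmul_pure _ _ (cev1 B) (part_homog b y (@cevK k A))) /=.
  by rewrite expr0 scale1r mulr1.
rewrite /tinl {1}hy mulrDr tpureDl -!H -tmulDr -tpureDl.
by rewrite -hy.
Qed.
Lemma tinr_monoid : monoid_morphism tinr.
Proof.
split=> // x y; rewrite /tinr.
have H b : tmul (1 \tp part (cev B) b x) (1 \tp y) = (1 : A) \tp (part (cev B) b x * y).
  rewrite (tmul_pure _ _ (part_homog b x (@cevK k B)) (cev1 A)) andbF.
  by rewrite expr0 scale1r mulr1.
rewrite {1}(partD (cev B) x) mulrDl tpureDr -!H -tmulDl -tpureDr.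
by rewrite -partD.
Qed.
HB.instance Definition _ := GRing.isMonoidMorphism.Build A AB tinl tinl_monoid.
HB.instance Definition _ := GRing.isMonoidMorphism.Build B AB tinr tinr_monoid.

Lemma tinl_ev x : tinl (cev A x) = cev AB (tinl x).
Proof. 
have h b := tev_pure (part_homog b x (@cevK k A)) (cev1 B).
have e0 : cev AB (tinl (part (cev A) false x)) = tinl (part (cev A) false x) := h false.
have e1 : cev AB (tinl (part (cev A) true x)) = 0 := h true.
have -> : tinl x = tinl (part (cev A) false x) + tinl (part (cev A) true x).
  by rewrite {1}(partD (cev A) x); apply: linearD.
by rewrite [RHS]linearD e0 e1 addr0.
Qed.
Lemma tinr_ev x : tinr (cev B x) = cev AB (tinr x).
Proof. 
have h b := tev_pure (cev1 A) (part_homog b x (@cevK k B)).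
have e0 : cev AB (tinr (part (cev B) false x)) = tinr (part (cev B) false x) := h false.
have e1 : cev AB (tinr (part (cev B) true x)) = 0 := h true.
have -> : tinr x = tinr (part (cev B) false x) + tinr (part (cev B) true x).
  by rewrite {1}(partD (cev B) x); apply: linearD.
by rewrite [RHS]linearD e0 e1 addr0.
Qed.
Definition tinl_shom : shom A AB := @Shom A AB tinl tinl_ev.
Definition tinr_shom : shom B AB := @Shom B AB tinr tinr_ev.
End Inclusions.
End Morphisms.

Section GL.
Variables (k : fieldType) (m n : nat).

(* Indices i < m are even, the others are odd. *)
Definition par (i : 'I_(m + n)) : bool := (m <= i)%N.

Section Points.
Variable A : csalg k.

Definition even_smx (g : 'M[A]_(m + n)) : Prop :=
  forall i j, homog (cev A) (par i (+) par j) (g i j).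

(* A point is stored together with its (unique) inverse. *)
Record GLpt := GLPt {
  gmx : 'M[A]_(m + n);
  ginv : 'M[A]_(m + n);
  gmx_even : even_smx gmx;
  ginv_even : even_smx ginv;
  gmxV : gmx *m ginv = 1%:M;
  gVmx : ginv *m gmx = 1%:M }.

Lemma even_smx1 : even_smx 1%:M.
Proof.
move=> i j; rewrite mxE; case: eqP => [->|_]; last exact: homog0.
by rewrite addbb; apply: cev1.
Qed.

Lemma even_smxM g h : even_smx g -> even_smx h -> even_smx (g *m h).
Proof.
move=> hg hh i j; rewrite mxE; apply: big_ind => [|x y|l _].
- exact: homog0.
- exact: homogD.
- by have := cevM (hg i l) (hh l j); rewrite addbA addbK.
Qed.

Definition GLone : GLpt :=
  GLPt even_smx1 even_smx1 (mul1mx _) (mul1mx _).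

Lemma GLmulV (g h : GLpt) : (gmx g *m gmx h) *m (ginv h *m ginv g) = 1%:M.
Proof. by rewrite mulmxA -(mulmxA (gmx g)) gmxV mulmx1 gmxV. Qed.
Lemma GLmulVl (g h : GLpt) : (ginv h *m ginv g) *m (gmx g *m gmx h) = 1%:M.
Proof. by rewrite mulmxA -(mulmxA (ginv h)) gVmx mulmx1 gVmx. Qed.

Definition GLmul (g h : GLpt) : GLpt :=
  GLPt (even_smxM (gmx_even g) (gmx_even h))
       (even_smxM (ginv_even h) (ginv_even g)) (GLmulV g h) (GLmulVl g h).

End Points.

Section Map.
Variables (A B : csalg k) (f : shom A B).

Lemma even_smx_map g : even_smx g -> even_smx (map_mx f g).
Proof. by move=> hg i j; rewrite mxE; apply: homog_shom. Qed.

Lemma GLmapV (g : GLpt A) : map_mx f (gmx g) *m map_mx f (ginv g) = 1%:M.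
Proof. by rewrite -map_mxM gmxV map_mx1. Qed.
Lemma GLmapVl (g : GLpt A) : map_mx f (ginv g) *m map_mx f (gmx g) = 1%:M.
Proof. by rewrite -map_mxM gVmx map_mx1. Qed.

Definition GLmap (g : GLpt A) : GLpt B :=
  GLPt (even_smx_map (gmx_even g)) (even_smx_map (ginv_even g))
       (GLmapV g) (GLmapVl g).

End Map.

(* Superpolynomials in the entries of a point and of its inverse. *)
Inductive gterm :=
  | GConst of k
  | GX of 'I_(m + n) & 'I_(m + n)
  | GV of 'I_(m + n) & 'I_(m + n)
  | GAdd of gterm & gterm
  | GMul of gterm & gterm.

HB.instance Definition _ := gen_eqMixin gterm.
HB.instance Definition _ := gen_choiceMixin gterm.

Fixpoint geval (A : csalg k) (g : GLpt A) (t : gterm) : A :=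
  match t with
  | GConst c => c%:A
  | GX i j => gmx g i j
  | GV i j => ginv g i j
  | GAdd s t => geval g s + geval g t
  | GMul s t => geval g s * geval g t
  end.

(* The coordinate superalgebra is the quotient by the relations that hold at all
   points; see coordGL_exists and coordGL_unique. *)
Definition geq : rel gterm := fun s t =>
  `[< forall (A : csalg k) (g : GLpt A), geval g s = geval g t >].

Lemma geq_refl : reflexive geq.
Proof. by move=> s; apply/asboolP. Qed.
Lemma geq_sym : symmetric geq.
Proof. by move=> s t; apply/asboolP/asboolP => h A g; rewrite h. Qed.
Lemma geq_trans : transitive geq.
Proof.
by move=> t s u /asboolP h /asboolP h'; apply/asboolP => A g; rewrite h h'.
Qed.
Canonical geq_equiv := EquivRel geq geq_refl geq_sym geq_trans.

Definition coord := {eq_quot geq}.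
HB.instance Definition _ : EqQuotient _ geq coord := EqQuotient.on coord.
HB.instance Definition _ := Choice.on coord.

Definition ceval (A : csalg k) (g : GLpt A) (x : coord) : A := geval g (repr x).

Lemma ceval_pi (A : csalg k) (g : GLpt A) t : ceval g (\pi_coord t) = geval g t.
Proof.
have : geq (repr (\pi_coord t)) t by apply/eqmodP; rewrite reprK.
by move/asboolP; apply.
Qed.

Lemma coord_ext (x y : coord) :
  (forall (A : csalg k) (g : GLpt A), ceval g x = ceval g y) -> x = y.
Proof.
elim/quotW: x => s; elim/quotW: y => t h.
by apply/eqmodP/asboolP => A g; rewrite -!ceval_pi.
Qed.

Definition cconst (c : k) : coord := \pi_coord (GConst c).
Definition cadd (x y : coord) : coord := \pi_coord (GAdd (repr x) (repr y)).
Definition cmul (x y : coord) : coord := \pi_coord (GMul (repr x) (repr y)).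
Definition cscale (c : k) (x : coord) : coord := cmul (cconst c) x.
Definition copp (x : coord) : coord := cscale (-1) x.

Section Eval.
Variables (A : csalg k) (g : GLpt A).
Lemma ceval_const c : ceval g (cconst c) = c%:A.
Proof. exact: ceval_pi. Qed.
Lemma ceval_add x y : ceval g (cadd x y) = ceval g x + ceval g y.
Proof. exact: ceval_pi. Qed.
Lemma ceval_mul x y : ceval g (cmul x y) = ceval g x * ceval g y.
Proof. exact: ceval_pi. Qed.
Lemma ceval_scale c x : ceval g (cscale c x) = c *: ceval g x.
Proof. by rewrite ceval_mul ceval_const -scalerAl mul1r. Qed.
Lemma ceval_opp x : ceval g (copp x) = - ceval g x.
Proof. by rewrite ceval_scale scaleN1r. Qed.
End Eval.

Local Ltac coord := move=> *; apply: coord_ext => ? ?;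
  rewrite ?(ceval_add, ceval_opp, ceval_scale, ceval_mul, ceval_const)
    ?scale0r ?scale1r //.

Lemma caddA : associative cadd. Proof. by coord; rewrite addrA. Qed.
Lemma caddC : commutative cadd. Proof. by coord; rewrite addrC. Qed.
Lemma cadd0 : left_id (cconst 0) cadd. Proof. by coord; rewrite add0r. Qed.
Lemma caddN : left_inverse (cconst 0) copp cadd. Proof. by coord; rewrite addNr. Qed.
HB.instance Definition _ := GRing.isZmodule.Build coord caddA caddC cadd0 caddN.

Lemma cmulA : associative cmul. Proof. by coord; rewrite mulrA. Qed.
Lemma cmul1l : left_id (cconst 1) cmul. Proof. by coord; rewrite mul1r. Qed.
Lemma cmul1r : right_id (cconst 1) cmul. Proof. by coord; rewrite mulr1. Qed.
Lemma cmulDl : left_distributive cmul +%R. Proof. by coord; rewrite mulrDl. Qed.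
Lemma cmulDr : right_distributive cmul +%R. Proof. by coord; rewrite mulrDr. Qed.
Lemma cone_neq0 : cconst 1 != 0.
Proof.
apply/eqP => h; have := ceval_const (GLone (ground k)) 1.
rewrite h; have -> : ceval (GLone (ground k)) 0 = 0.
  by rewrite ceval_const scale0r.
by rewrite scale1r => /eqP; rewrite eq_sym oner_eq0.
Qed.
HB.instance Definition _ := GRing.Zmodule_isNzRing.Build coord
  cmulA cmul1l cmul1r cmulDl cmulDr cone_neq0.

Lemma cscaleA a b x : cscale a (cscale b x) = cscale (a * b) x.
Proof. by coord; rewrite scalerA. Qed.
Lemma cscale1 : left_id 1 cscale. Proof. by coord. Qed.
Lemma cscaleDr : right_distributive cscale +%R.
Proof. by coord; rewrite -scalerDr. Qed.
Lemma cscaleDl x : {morph cscale^~ x : a b / a + b}.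
Proof. by coord; rewrite scalerDl. Qed.
HB.instance Definition _ :=
  GRing.Zmodule_isLmodule.Build k coord cscaleA cscale1 cscaleDr cscaleDl.
Lemma cscaleAl a (x y : coord) : a *: (x * y) = (a *: x) * y.
Proof. by coord; rewrite scalerAl. Qed.
Lemma cscaleAr a (x y : coord) : a *: (x * y) = x * (a *: y).
Proof. by coord; rewrite scalerAr. Qed.
HB.instance Definition _ := GRing.Lmodule_isLalgebra.Build k coord cscaleAl.
HB.instance Definition _ := GRing.Lalgebra_isAlgebra.Build k coord cscaleAr.

Section EvalMorphism.
Variables (A : csalg k) (g : GLpt A).
Lemma ceval_linear : linear (ceval g).
Proof. by move=> a x y; rewrite ceval_add ceval_scale. Qed.
HB.instance Definition _ := GRing.isLinear.Build k coord A _ (ceval g) ceval_linear.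
Lemma ceval_monoid : monoid_morphism (ceval g).
Proof. by split=> [|x y]; rewrite ?ceval_mul // ceval_const scale1r. Qed.
HB.instance Definition _ := GRing.isMonoidMorphism.Build coord A (ceval g) ceval_monoid.
End EvalMorphism.

Lemma part_mul (A : csalg k) b (x y : A) :
  part (cev A) b (x * y) = part (cev A) false x * part (cev A) b y
                         + part (cev A) true x * part (cev A) (~~ b) y.
Proof.
have P c z := part_homog c z (@cevK k A).
have pD u v : part (cev A) b (u + v) = part (cev A) b u + part (cev A) b v.
  by have := part_linear (cev A) b 1 u v; rewrite !scale1r.
have := partD (cev A) y; have := partD (cev A) x.
have -> : part (cev A) b y = if b then part (cev A) true y else part (cev A) false y.
  by case: (b).
have -> : part (cev A) (~~ b) y = if b then part (cev A) false y else part (cev A) true y.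
  by case: (b).
have := P true y; have := P false y; have := P true x; have := P false x.
move: (part (cev A) false x) (part (cev A) true x) (part (cev A) false y)
  (part (cev A) true y) => x0 x1 y0 y1 hx0 hx1 hy0 hy1 -> ->.
rewrite mulrDl !mulrDr !pD !(part_id (cevM hx0 hy0)) !(part_id (cevM hx0 hy1)).
rewrite !(part_id (cevM hx1 hy0)) !(part_id (cevM hx1 hy1)).
by case: b {pD}; rewrite /= ?addr0 ?add0r // addrC.
Qed.

(* gpart b t is the component of parity b of the superpolynomial t. *)
Fixpoint gpart (b : bool) (t : gterm) : gterm :=
  match t with
  | GConst c => GConst (if b then 0 else c)
  | GX i j => if b == par i (+) par j then GX i j else GConst 0
  | GV i j => if b == par i (+) par j then GV i j else GConst 0
  | GAdd s t => GAdd (gpart b s) (gpart b t)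
  | GMul s t => GAdd (GMul (gpart false s) (gpart b t))
                     (GMul (gpart true s) (gpart (~~ b) t))
  end.

Lemma geval_gpart (A : csalg k) (g : GLpt A) b t :
  geval g (gpart b t) = part (cev A) b (geval g t).
Proof.
elim: t b => [c|i j|i j|s hs t ht|s hs t ht] b /=.
- have h : homog (cev A) false (c%:A) by apply/homogZ/cev1.
  by rewrite (part_id h) eq_sym; case: b => //=; rewrite scale0r.
- rewrite (part_id (gmx_even g i j)) eq_sym.
  by case: ifP => //=; rewrite scale0r.
- rewrite (part_id (ginv_even g i j)) eq_sym.
  by case: ifP => //=; rewrite scale0r.
- have := part_linear (cev A) b 1 (geval g s) (geval g t).
  by rewrite !scale1r hs ht.
rewrite !hs !ht.
by rewrite part_mul.
Qed.

Definition cpart (x : coord) : coord := \pi_coord (gpart false (repr x)).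

Lemma ceval_cpart (A : csalg k) (g : GLpt A) x :
  ceval g (cpart x) = cev A (ceval g x).
Proof. by rewrite ceval_pi geval_gpart. Qed.

Lemma cpart_linear : linear cpart.
Proof.
move=> a x y; apply: coord_ext => A g.
by rewrite ceval_cpart !linearP /= !ceval_cpart.
Qed.
HB.instance Definition _ := GRing.isLinear.Build k coord coord _ cpart cpart_linear.

Lemma cpartK x : cpart (cpart x) = cpart x.
Proof. by apply: coord_ext => A g; rewrite !ceval_cpart cevK. Qed.

Lemma homog_coord b x :
  (forall (A : csalg k) (g : GLpt A), homog (cev A) b (ceval g x)) ->
  homog cpart b x.
Proof.
move=> h; apply: coord_ext => A g; rewrite ceval_cpart (h A g).
by case: b {h}; rewrite ?linear0.
Qed.

Lemma homog_ceval (A : csalg k) (g : GLpt A) b x :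
  homog cpart b x -> homog (cev A) b (ceval g x).
Proof. by rewrite /homog -ceval_cpart => ->; case: b; rewrite ?linear0. Qed.

Lemma cpart1 : homog cpart false 1.
Proof. by apply: homog_coord => A g; rewrite rmorph1; apply: cev1. Qed.

Lemma cpartM b c x y : homog cpart b x -> homog cpart c y ->
  homog cpart (b (+) c) (x * y).
Proof.
by move=> hx hy; apply: homog_coord => A g; rewrite rmorphM;
  apply: cevM; apply: homog_ceval.
Qed.

Lemma cpartC b c x y : homog cpart b x -> homog cpart c y ->
  x * y = (-1) ^+ (b && c) * (y * x).
Proof.
move=> hx hy; apply: coord_ext => A g; rewrite !rmorphM rmorph_sign /=.
by apply: cevC; apply: homog_ceval.
Qed.

Definition coordGL : csalg k := Csalg cpartK cpart1 cpartM cpartC.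

Lemma ceval_ev (A : csalg k) (g : GLpt A) (x : coordGL) :
  ceval g (cev coordGL x) = cev A (ceval g x).
Proof. exact: ceval_cpart. Qed.
Definition ceval_shom (A : csalg k) (g : GLpt A) : shom coordGL A :=
  @Shom k coordGL A (ceval g) (ceval_ev g).

Definition cX : 'M[coordGL]_(m + n) := \matrix_(i, j) \pi_coord (GX i j).
Definition cV : 'M[coordGL]_(m + n) := \matrix_(i, j) \pi_coord (GV i j).

Lemma ceval_X (A : csalg k) (g : GLpt A) i j : ceval g (cX i j) = gmx g i j.
Proof. by rewrite mxE ceval_pi. Qed.
Lemma ceval_V (A : csalg k) (g : GLpt A) i j : ceval g (cV i j) = ginv g i j.
Proof. by rewrite mxE ceval_pi. Qed.

Lemma cX_even : even_smx cX.
Proof. by move=> i j; apply: homog_coord => A g; rewrite ceval_X; apply: gmx_even. Qed.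
Lemma cV_even : even_smx cV.
Proof. by move=> i j; apply: homog_coord => A g; rewrite ceval_V; apply: ginv_even. Qed.

Lemma cXV : cX *m cV = 1%:M.
Proof.
apply/matrixP=> i j; apply: coord_ext => A g.
rewrite [in LHS]mxE rmorph_sum [in RHS]mxE rmorph_nat.
have /matrixP/(_ i j) := gmxV g; rewrite mxE [in RHS]mxE => <-.
by apply: eq_bigr => l _; rewrite rmorphM /= ceval_X ceval_V.
Qed.
Lemma cVX : cV *m cX = 1%:M.
Proof.
apply/matrixP=> i j; apply: coord_ext => A g.
rewrite [in LHS]mxE rmorph_sum [in RHS]mxE rmorph_nat.
have /matrixP/(_ i j) := gVmx g; rewrite mxE [in RHS]mxE => <-.
by apply: eq_bigr => l _; rewrite rmorphM /= ceval_X ceval_V.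
Qed.

Definition cgen : GLpt coordGL := GLPt cX_even cV_even cXV cVX.

(* Representability: superalgebra morphisms from coordGL to A are the points of
   the supergroup over A. *)
Lemma coordGL_exists (A : csalg k) (g : GLpt A) :
  gmx (GLmap (ceval_shom g) cgen) = gmx g.
Proof. by apply/matrixP=> i j; rewrite mxE; apply: ceval_X. Qed.

Lemma coordGL_unique (A : csalg k) (f f' : shom coordGL A) :
  gmx (GLmap f cgen) = gmx (GLmap f' cgen) -> f =1 f'.
Proof.
move=> hX.
have hV : ginv (GLmap f cgen) = ginv (GLmap f' cgen).
  rewrite -[LHS]mulmx1 -(gmxV (GLmap f' cgen)) mulmxA -hX.
  by rewrite gVmx mul1mx.
have fX i j : f (cX i j) = f' (cX i j).
  by have /matrixP/(_ i j) := hX; rewrite !mxE.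
have fV i j : f (cV i j) = f' (cV i j).
  by have /matrixP/(_ i j) := hV; rewrite !mxE.
elim/quotW; elim=> [c|i j|i j|s hs t ht|s hs t ht].
- have -> : \pi_coord (GConst c) = c%:A :> coordGL.
    apply: coord_ext => A' g; rewrite ceval_pi linearZ /=.
    by congr (_ *: _); rewrite rmorph1.
  by rewrite !linearZ !rmorph1.
- by have := fX i j; rewrite mxE.
- by have := fV i j; rewrite mxE.
- have -> : \pi_coord (GAdd s t) = \pi_coord s + \pi_coord t :> coordGL.
    by apply: coord_ext => A' g; rewrite linearD /= !ceval_pi.
  by rewrite !linearD /= hs ht.
- have -> : \pi_coord (GMul s t) = (\pi_coord s : coordGL) * \pi_coord t.
    by apply: coord_ext => A' g; rewrite rmorphM /= !ceval_pi.
  by rewrite !rmorphM /= hs ht.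
Qed.

Definition counit : coordGL -> k := ceval (GLone (ground k)).

Lemma counit_linear : linear (counit : coordGL -> k^o).
Proof. by move=> a x y; apply: (ceval_linear (GLone (ground k)) a x y). Qed.

Lemma tone_coord_neq0 : tone coordGL coordGL != 0.
Proof.
pose b (x y : coordGL) : k^o := counit x * counit y.
have hb : bilin b.
  split=> [x|y] a u v; rewrite /b counit_linear; first by rewrite mulrDr scalerAr.
  by rewrite mulrDl scalerAl.
apply/eqP => h; have := tlift_pure 1 1 hb.
rewrite -[1 \tp 1]/(tone coordGL coordGL) h (tlift_0 hb) /b /counit rmorph1 mulr1.
by move=> /eqP; rewrite eq_sym oner_eq0.
Qed.

Definition coordGL2 : csalg k := tens_csalg tone_coord_neq0.

(* Dual to the product of points: the universal pair of points is multiplied, so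
   that the (i, j) entry goes to the sum over l of x_il (x) x_lj. *)
Definition comul : coordGL -> tens coordGL coordGL :=
  ceval (GLmul (GLmap (tinl_shom tone_coord_neq0) cgen)
               (GLmap (tinr_shom tone_coord_neq0) cgen)).

Lemma comul_linear : linear (comul : coordGL -> tens coordGL coordGL).
Proof.
by move=> a x y; apply: (ceval_linear (GLmul (GLmap (tinl_shom tone_coord_neq0) cgen)
  (GLmap (tinr_shom tone_coord_neq0) cgen)) a x y).
Qed.

Lemma comul_X i j : comul (cX i j) = \sum_l cX i l \tp cX l j.
Proof.
rewrite /comul [LHS]ceval_X /= mxE; apply: eq_bigr => l _.
have h := tmul_pure (cX i l) (cX l j) (cev1 coordGL) (cev1 coordGL).
rewrite mxE [in X in _ * X]mxE [LHS]h.
by rewrite /= expr0 scale1r mulr1 mul1r.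
Qed.

End GL.

Section Supermodules.
Variables (k : fieldType) (m n : nat).
Local Notation C := (coordGL k m n).

(* Right supercomodules over the coordinate Hopf superalgebra; both sides of
   coassociativity are read in M (x) (C (x) C). *)
Record supermodule := Supermodule {
  smsp :> superspace k;
  coact : {linear smsp -> tens smsp C};
  coact_ev : forall v, coact (ev smsp v) = tev (ev smsp) (cev C) (coact v);
  coact_counit : forall v,
    tlift (fun w c => counit c *: w) (coact v) = v;
  coact_comul : forall v,
    tlift (fun w c => tlift (fun w' c' => w' \tp (c' \tp c)) (coact w)) (coact v)
    = tlift (fun w c => w \tp comul c) (coact v) }.

(* No parity is required: the linear maps commuting with the coactions form
   the superspace of all homomorphisms, even and odd. *)
Definition is_hom (M N : supermodule) (f : {linear M -> N}) : Prop :=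
  forall v, coact N (f v) = tlift (fun w c => f w \tp c) (coact M v).

Definition is_even_hom (M N : supermodule) (f : {linear M -> N}) : Prop :=
  is_hom f /\ forall v, f (ev M v) = ev N (f v).

(* The category has even homomorphisms; its monomorphisms are the injective
   ones. *)
Definition is_injective (I : supermodule) : Prop :=
  forall (M N : supermodule) (i : {linear M -> N}) (f : {linear M -> I}),
    is_even_hom i -> injective i -> is_even_hom f ->
    exists g : {linear N -> I}, is_even_hom g /\ forall v, g (i v) = f v.

Record injective_resolution (N : supermodule) := InjectiveResolution {
  ires :> nat -> supermodule;
  iaug : {linear N -> ires 0};
  idiff : forall i, {linear ires i -> ires i.+1};
  iresP : forall i, is_injective (ires i);
  iaug_hom : is_even_hom iaug;
  idiff_hom : forall i, is_even_hom (idiff i);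
  iaug_inj : injective iaug;
  iexact0 : forall x, idiff 0 x = 0 <-> exists v, x = iaug v;
  iexactS : forall i x, idiff i.+1 x = 0 <-> exists y, x = idiff i y }.

Section Ext.
Variables (M N : supermodule) (R : injective_resolution N).

Definition ext_cocycle i (f : {linear M -> R i}) : Prop :=
  is_hom f /\ forall v, idiff R i (f v) = 0.

Definition ext_coboundary i : {linear M -> R i} -> Prop :=
  match i with
  | 0 => fun f => forall v, f v = 0
  | j.+1 => fun f => exists h : {linear M -> R j},
      is_hom h /\ forall v, f v = idiff R j (h v)
  end.

End Ext.

(* The i-th cohomology of the complex Hom(M, R) is nonzero, where R is an
   injective resolution of N; it does not depend on the choice of R. *)
Definition Ext_neq0 (i : nat) (M N : supermodule) : Prop :=
  exists (R : injective_resolution N) (f : {linear M -> R i}),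
    ext_cocycle f /\ ~ ext_coboundary f.

Local Notation K := (csalg_superspace (ground k)).

Definition triv_coact (a : K) : tens K C := a \tp (1 : C).

Lemma triv_coact_linear : linear triv_coact.
Proof. exact: ((bilin_pure K C).2 1). Qed.
HB.instance Definition _ :=
  GRing.isLinear.Build k K (tens K C) _ triv_coact triv_coact_linear.

Lemma triv_coact_ev v :
  triv_coact (ev K v) = tev (ev K) (cev C) (triv_coact v).
Proof.
have hv : homog (ev K) false v by [].
exact: (esym (tev_pure hv (cev1 C))).
Qed.

Lemma triv_coact_counit v :
  tlift (fun (w : K) c => counit c *: w) (triv_coact v) = v.
Proof.
rewrite tlift_pure; first by rewrite /counit rmorph1 scale1r.
split=> [w a c c'|c a w w']; last by rewrite scalerDr !scalerA mulrC.
by rewrite counit_linear scalerDl scalerA.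
Qed.

Lemma triv_coact_comul v :
  tlift (fun w c => tlift (fun w' c' => w' \tp (c' \tp c)) (triv_coact w))
    (triv_coact v)
  = tlift (fun w c => w \tp comul c) (triv_coact v).
Proof.
have b1 (c : C) : bilin (fun (w' : K) (c' : C) => w' \tp (c' \tp c)).
  split=> [w a x y|x a w w']; last exact: (bilin_pure _ _).2.
  by rewrite ((bilin_pure C C).2 c) ((bilin_pure K (tens C C)).1 w).
have E w (c : C) : tlift (fun (w' : K) (c' : C) => w' \tp (c' \tp c)) (triv_coact w)
             = w \tp ((1 : C) \tp c) by rewrite (tlift_pure _ _ (b1 c)).
have -> : (fun (w : K) (c : C) => tlift (fun (w' : K) (c' : C) => w' \tp (c' \tp c)) (triv_coact w))
   = (fun (w : K) (c : C) => w \tp ((1 : C) \tp c)) by apply/funext=> w; apply/funext=> c.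
rewrite !tlift_pure; first by congr (_ \tp _); rewrite /comul rmorph1.
- apply: (bilin_comp _ _ (bilin_pure _ _)) => //; exact: comul_linear.
- apply: (bilin_comp _ _ (bilin_pure _ _)) => //; exact: ((bilin_pure C C).1 1).
Qed.

Definition triv : supermodule :=
  @Supermodule K triv_coact triv_coact_ev triv_coact_counit triv_coact_comul.

End Supermodules.

(* All algebraic extensions of k are separable. *)
Definition perfect_field (k : fieldType) : Prop :=
  forall q : {poly k}, irreducible_poly q -> separable_poly q.

(* Main.v *)
(* In characteristic p the sequence 0 -> V_0^(1) -> S^p V -> Gamma^p V -> V_0^(1) -> 0
   of functors of a superspace V = V_0 + V_1 is exact, where ^(1) is the Frobenius
   twist; taking for V the natural module of GL(m|n) and the trace of this 2-extension
   gives a class in Ext^2(k, k).  Its cocycle is F(g, h) = tr (W(g, h) N(gh)^-1), where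
   N(g) is made of the p-th powers of the entries of the upper left block and W(g, h)
   measures, by the addition polynomial of Witt vectors, how far the entries of the
   product gh are from being added after taking Teichmueller lifts.
   The class does not vanish: in the queer subgroup of the matrices [[a, b], [b, a]] of
   GL(1|1), with a^p = 1, take g = (x, x s) and h = (1, s').  Then F(g, h) = - s s',
   whereas the coefficient of x^0 s s' vanishes on u(g), u(h) and u(gh) for every
   function u: for the last one because u(gh) is u(g) transported by the comultiplication
   x |-> x (1 + s s'), which sends x^j to x^j + j x^j s s'.
   Ext is computed by the cobar resolution N, N (x) C, N (x) C (x) C, ... *)
From HB Require Import structures.
Require Import Defs.
From mathcomp Require Import all_boot all_algebra all_field.
From mathcomp Require Import boolp classical_sets qpoly.
From mathcomp Require Import ring zify.
Set Implicit Arguments.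
Unset Strict Implicit.
Unset Printing Implicit Defensive.
Import GRing.Theory.
Local Open Scope ring_scope.

(** * The addition polynomial of Witt vectors *)

Section CoefBelow.
Variables (R : comNzRingType) (I : Type).
Implicit Types (r : seq I) (u v : I -> {poly R}).

(** The hypothesis says that [u t] is [v t] with [c * 'X] substituted for ['X], and substitution
    commutes with products. *)
Lemma coef_prod_scale r u v c :
  (forall t i, (u t)`_i = c ^+ i * (v t)`_i) ->
  forall i, (\prod_(t <- r) u t)`_i = c ^+ i * (\prod_(t <- r) v t)`_i.
Proof.
move=> uv; elim: r => [|t r ih] i.
  rewrite !big_nil !coef1; case: i => [|i]; first by rewrite expr0 mul1r.
  by rewrite mulr0.
rewrite !big_cons !coefM mulr_sumr; apply: eq_bigr => -[j /= ltji] _.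
by rewrite uv ih mulrACA -exprD subnKC.
Qed.

Lemma coef_prod_below p r u v :
  (forall t i, (i < p)%N -> (u t)`_i = (v t)`_i) ->
  forall i, (i < p)%N -> (\prod_(t <- r) u t)`_i = (\prod_(t <- r) v t)`_i.
Proof.
move=> uv; elim: r => [|t r ih] i ltip; first by rewrite !big_nil.
rewrite !big_cons !coefM; apply: eq_bigr => -[j /= ltji] _.
by rewrite uv ?ih //; apply: leq_ltn_trans ltip; rewrite // leq_subr.
Qed.

Lemma coef0_prod r u : (forall t, (u t)`_0 = 1) -> (\prod_(t <- r) u t)`_0 = 1.
Proof.
move=> u1; elim: r => [|t r ih]; first by rewrite big_nil coef1.
by rewrite big_cons coefM big_ord_recl big_ord0 u1 ih addr0 mul1r.
Qed.

(** All constant coefficients are 1, so a coefficient of degree [p] of one factor meets only 1 in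
    the others and enters additively; everything else depends on coefficients below degree [p]. *)
Lemma coef_prod_top p r u v : (0 < p)%N ->
  (forall t i, (i < p)%N -> (u t)`_i = (v t)`_i) -> (forall t, (v t)`_0 = 1) ->
  (\prod_(t <- r) u t)`_p
  = (\prod_(t <- r) v t)`_p + \sum_(t <- r) ((u t)`_p - (v t)`_p).
Proof.
case: p => // q _ uv v1; have u1 t : (u t)`_0 = 1 by rewrite uv.
 elim: r => [|t r ih].
  by rewrite !big_nil addr0.
have coefMS (f g : {poly R}) : (f * g)`_q.+1 =
    f`_0 * g`_q.+1 + (\sum_(i < q) f`_(1 + i) * g`_(q.+1 - (1 + i)) + f`_q.+1 * g`_0).
  rewrite coefM big_ord_recl big_ord_recr /= subn0 /bump !leq0n add1n subnn.
  by congr (_ + (_ + _)); apply: eq_bigr.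
rewrite !big_cons !coefMS !(coef0_prod r) // u1 v1 !mul1r !mulr1 ih.
have -> : \sum_(i < q) (u t)`_(1 + i) * (\prod_(j <- r) u j)`_(q.+1 - (1 + i))
  = \sum_(i < q) (v t)`_(1 + i) * (\prod_(j <- r) v j)`_(q.+1 - (1 + i)).
  apply: eq_bigr => -[i /= ltiq] _; rewrite uv //; congr (_ * _).
  by apply: coef_prod_below => [s j|]; [exact: uv|lia].
by ring.
Qed.

End CoefBelow.

Section WittPolynomial.
Variables (p : nat) (R : comNzRingType).
Hypothesis (charR : p \in [pchar R]).

(* [1 / i!] for [i < p], by Wilson's theorem. *)
Definition invfact (i : nat) : R := (-1) ^+ i.+1 * ((p.-1 - i)`!)%:R.

(** Wilson's theorem is the case [i = 0]. In the induction step the factor [i.+1] gained by one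
    factorial is, modulo [p], minus the factor [p - i.+1] lost by the other. *)
Lemma invfactK i : (i < p)%N -> invfact i * i`!%:R = 1.
Proof.
have pr_p := pcharf_prime charR; rewrite /invfact.
elim: i => [|i ih] ltip.
  have := Wilson (prime_gt1 pr_p); rewrite pr_p (dvdn_pcharf charR) -addn1 natrD.
  rewrite subn0 expr1 mulr1 mulN1r addr_eq0 => /esym/eqP ->; exact: opprK.
rewrite -[RHS](ih (ltnW ltip)).
have -> : (p.-1 - i = (p.-1 - i.+1).+1)%N by lia.
rewrite !factS !natrM exprS.
have -> : ((p.-1 - i.+1).+1)%:R = - (i.+1)%:R :> R.
  apply/eqP; rewrite -addr_eq0 -natrD.
  have -> : ((p.-1 - i.+1).+1 + i.+1 = p)%N by lia.
  by rewrite (pcharf0 charR).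
by ring.
Qed.

Lemma invfact0 : invfact 0 = 1.
Proof.
by rewrite -[RHS](@invfactK 0) ?mulr1 // (prime_gt0 (pcharf_prime charR)).
Qed.

(** The series exp(aX) cut off at degree [p], where [i!] stops being invertible. *)
Definition texp (a : R) : {poly R} := \poly_(i < p) (invfact i * a ^+ i).

Lemma coef_texp a i : (i < p)%N -> (texp a)`_i = invfact i * a ^+ i.
Proof. by move=> ltip; rewrite coef_poly ltip. Qed.

Lemma coef_texp_top a : (texp a)`_p = 0.
Proof. by rewrite coef_poly ltnn. Qed.

Lemma coef0_texp a : (texp a)`_0 = 1.
Proof.
have p_gt0 := prime_gt0 (pcharf_prime charR).
by rewrite coef_texp // expr0 invfact0 mulr1.
Qed.

(** The binomial formula with the factorials distributed between the two factors; all of them are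
    invertible in these degrees. *)
Lemma coef_texpD a b i : (i < p)%N -> (texp (a + b))`_i = (texp a * texp b)`_i.
Proof.
move=> ltip; rewrite coef_texp // coefM addrC exprDn mulr_sumr.
apply: eq_bigr => -[j /= ltji] _; have leji : (j <= i)%N by [].
have ltjp : (j < p)%N by lia.
have ltijp : (i - j < p)%N by lia.
rewrite !coef_texp //.
transitivity (invfact i * (b ^+ (i - j) * a ^+ j * 'C(i, j)%:R)
    * (invfact j * j`!%:R) * (invfact (i - j) * (i - j)`!%:R)).
  by rewrite !invfactK // !mulr1 mulr_natr.
transitivity ((invfact i * i`!%:R) * (invfact j * a ^+ j * (invfact (i - j) * b ^+ (i - j)))).
  by rewrite -(bin_fact leji) !natrM; ring.
by rewrite invfactK // mul1r.
Qed.

Lemma coef_texp_sum (I : Type) (r : seq I) (z : I -> R) i : (i < p)%N ->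
  (texp (\sum_(t <- r) z t))`_i = (\prod_(t <- r) texp (z t))`_i.
Proof.
elim: r i => [|t r ih] i ltip.
  rewrite !big_nil coef_texp // coef1 expr0n; case: i ltip => [|i] ltip.
    by rewrite invfact0 mulr1.
  by rewrite mulr0.
rewrite !big_cons coef_texpD // !coefM; apply: eq_bigr => -[j /= ltji] _.
by rewrite ih //; lia.
Qed.

(* Since the truncated exponential is multiplicative below degree [p], this
   measures the failure of multiplicativity; up to a unit it is
   [((\sum z)^p - \sum z^p) / p], the addition polynomial of Witt vectors. *)
Definition witt (I : finType) (z : I -> R) : R := (\prod_t texp (z t))`_p.

(** Below degree [p] each inner product agrees with the truncated exponential of its sum, so
    [coef_prod_top] isolates the corrections in degree [p]. *)
Lemma witt_block (I J : finType) (z : I -> J -> R) :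
  (\prod_s \prod_t texp (z s t))`_p
  = witt (fun s => \sum_t z s t) + \sum_s witt (z s).
Proof.
rewrite (@coef_prod_top _ _ p _ _ (fun s => texp (\sum_t z s t))).
- by congr (_ + _); apply: eq_bigr => s _; rewrite coef_texp_top subr0.
- exact: prime_gt0 (pcharf_prime charR).
- by move=> s i ltip; rewrite coef_texp_sum.
- by move=> s; apply: coef0_texp.
Qed.

(** The same double product is grouped by rows or by columns. This symmetry is the source of the
    cocycle identity [teich_cocycle]. *)
Lemma witt_exchange (I J : finType) (z : I -> J -> R) :
  witt (fun s => \sum_t z s t) + \sum_s witt (z s)
  = witt (fun t => \sum_s z s t) + \sum_t witt (z^~ t).
Proof. by rewrite -!witt_block exchange_big. Qed.

Lemma eq_witt (I : finType) (z w : I -> R) : z =1 w -> witt z = witt w.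
Proof.
by move=> zw; rewrite /witt (eq_bigr (fun t => texp (w t))) // => t _; rewrite zw.
Qed.

Lemma wittZ (I : finType) (c : R) (z : I -> R) :
  witt (fun t => c * z t) = c ^+ p * witt z.
Proof.
apply: coef_prod_scale => t i; rewrite !coef_poly.
by case: ifP; rewrite ?mulr0 // exprMn mulrCA.
Qed.

Lemma texp_square_zero a : a ^+ 2 = 0 -> texp a = 1 + a%:P * 'X.
Proof.
have pgt1 := prime_gt1 (pcharf_prime charR).
move=> a0; apply/polyP => i; rewrite coef_poly coefD coef1 coefCM coefX.
case: i => [|[|i]] /=; rewrite ?mulr0 ?addr0 ?add0r ?mulr1.
- by rewrite ltnW // invfact0 ?expr0 ?mulr1.
- rewrite pgt1 expr1 -[RHS]mul1r -(invfactK pgt1).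
  by rewrite mulr1.
- by case: ifP => // _; rewrite !exprS (mulrA a) -expr2 a0 mul0r mulr0.
Qed.

Lemma texp0 : texp 0 = 1.
Proof. by rewrite texp_square_zero ?expr0n // mul0r addr0. Qed.

(** The product of the truncated exponentials is linear in ['X], and [p] is at least 2. This
    disposes of families sharing an odd factor. *)
Lemma witt_square_zero (I : finType) (z : I -> R) :
  (forall s t, z s * z t = 0) -> witt z = 0.
Proof.
move=> z0; have pgt1 := prime_gt1 (pcharf_prime charR).
rewrite /witt.
have -> : \prod_t texp (z t) = 1 + (\sum_t z t)%:P * 'X.
  rewrite (eq_bigr _ (fun t _ => texp_square_zero (z0 t t))).
  have z0s r t : z t * \sum_(s <- r) z s = 0.
    by rewrite mulr_sumr big1 // => s _; apply: z0.
  elim: (index_enum I) => [|t r ih]; first by rewrite !big_nil mul0r addr0.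
  rewrite !big_cons ih polyCD.
  have := congr1 polyC (z0s r t); rewrite polyCM => h.
  have -> : (1 + (z t)%:P * 'X) * (1 + (\sum_(j <- r) z j)%:P * 'X)
    = 1 + ((z t)%:P + (\sum_(j <- r) z j)%:P) * 'X
      + ((z t)%:P * (\sum_(j <- r) z j)%:P) * 'X ^+ 2 by ring.
  by rewrite h mul0r addr0.
by rewrite coefD coef1 coefCM coefX; case: p pgt1 => [|[|q]] //= _; rewrite mulr0 addr0.
Qed.

Lemma witt_single (I : finType) (z : I -> R) i :
  (forall t, t != i -> z t = 0) -> witt z = 0.
Proof.
move=> z0; rewrite /witt (bigD1 i) //= big1 ?mulr1 ?coef_texp_top // => t ti.
by rewrite z0 // texp0.
Qed.

(** The second factor is [1 + a e X], so the coefficient wanted is [a e] times that of degree [p.-1]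
    in [texp a], where [invfact p.-1] equals -1. *)
Lemma witt_pair (I : finType) (z : I -> R) i j a e : i != j -> e ^+ 2 = 0 ->
  z i = a -> z j = a * e -> (forall t, t != i -> t != j -> z t = 0) ->
  witt z = - (a ^+ p * e).
Proof.
move=> ij e0 zi zj z0; have p_gt0 := prime_gt0 (pcharf_prime charR).
rewrite /witt (bigD1 i) // (bigD1 j) /=; last by rewrite eq_sym.
rewrite big1 ?mulr1 => [|t /andP[ti tj]]; last by rewrite z0 // texp0.
rewrite zi zj (texp_square_zero (_ : (a * e) ^+ 2 = 0)); last by rewrite exprMn e0 mulr0.
rewrite mulrDr mulr1 coefD coef_texp_top add0r mulrA coefMX mulrC coefCM.
rewrite (gtn_eqF p_gt0) coef_texp ?prednK // /invfact subnn mulr1 prednK //.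
have -> : (-1) ^+ p = -1 :> R by rewrite -(pFrobenius_autE charR) rmorphN1.
rewrite mulN1r mulrN; congr (- _).
by rewrite -[in RHS](prednK p_gt0) exprS mulrAC.
Qed.
End WittPolynomial.

Lemma rmorph_witt p (R S : comNzRingType) (f : {rmorphism R -> S}) (I : finType)
  (z : I -> R) : f (witt p z) = witt p (fun t => f (z t)).
Proof.
have E a : map_poly f (texp p a) = texp p (f a).
  apply/polyP => i; rewrite coef_map !coef_poly /=; case: ifP => _; last exact: rmorph0.
  by rewrite !rmorphM /= !rmorphXn rmorphN1 rmorph_nat.
rewrite /witt -coef_map rmorph_prod /=.
by rewrite (eq_bigr _ (fun t _ => E (z t))).
Qed.

(** * The trace cocycle on points *)

Section EvenPart.
Variables (k : fieldType) (A : csalg k).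

Definition is_even : {pred A} := fun x => cev A x == x.

Lemma is_evenP x : reflect (homog (cev A) false x) (x \in is_even).
Proof. exact: eqP. Qed.

Lemma is_even_subring : subring_closed is_even.
Proof.
split=> [|x y hx hy|x y hx hy].
- by apply/is_evenP/cev1.
- by move/is_evenP: hx; move/is_evenP: hy => hy hx; apply/eqP; rewrite linearB /= hx hy.
- move/is_evenP: hx; move/is_evenP: hy => hy hx; apply/is_evenP.
  exact: (cevM hx hy).
Qed.
HB.instance Definition _ := GRing.isSubringClosed.Build A is_even is_even_subring.

(** Even elements commute with one another, so they form a commutative ring over which [witt] and
    the trace make sense. *)
Record even_part := EvenPart { even_val :> A; even_valP : even_val \in is_even }.
HB.instance Definition _ := [isSub for even_val].
HB.instance Definition _ := [Choice of even_part by <:].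
HB.instance Definition _ := [SubChoice_isSubNzRing of even_part by <:].

Lemma even_mulC : commutative (@GRing.mul even_part).
Proof.
move=> x y; apply/val_inj; rewrite !rmorphM /=.
have := cevC (is_evenP _ (valP x)) (is_evenP _ (valP y)).
by rewrite /= expr0 mul1r.
Qed.
HB.instance Definition _ := GRing.PzRing_hasCommutativeMul.Build even_part even_mulC.

Lemma even_proj_subproof x : cev A x \in is_even.
Proof. by apply/eqP; rewrite cevK. Qed.
(** Total on [A], so that matrices over the even part can be written without parity proofs; it is
    additive everywhere and multiplicative on even elements. *)
Definition even_proj x : even_part := EvenPart (even_proj_subproof x).

Lemma even_projK x : homog (cev A) false x -> val (even_proj x) = x.
Proof. by []. Qed.

Lemma even_proj_zmod : zmod_morphism even_proj.
Proof. by move=> x y; apply/val_inj; rewrite /= linearB. Qed.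
HB.instance Definition _ := GRing.isZmodMorphism.Build _ _ even_proj even_proj_zmod.

Lemma even_pchar p : p \in [pchar k] -> p \in [pchar even_part].
Proof.
move=> charp; apply/andP; split; first exact: (pcharf_prime charp).
apply/eqP/val_inj; rewrite rmorph_nat rmorph0.
by rewrite -scaler_nat (pcharf0 charp) scale0r.
Qed.

End EvenPart.

Section EvenMap.
Variables (k : fieldType) (A B : csalg k) (f : shom A B).

Definition even_map (x : even_part A) : even_part B := even_proj (f (val x)).

Lemma even_mapE x : even_val (even_map x) = f (even_val x).
Proof. exact: (even_projK (homog_shom f (is_evenP _ (valP x)))). Qed.

Lemma even_map_zmod : zmod_morphism even_map.
Proof. by move=> x y; apply/val_inj; rewrite /= !linearB. Qed.
Lemma even_map_monoid : monoid_morphism even_map.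
Proof.
split=> [|x y]; apply/val_inj; first by rewrite [LHS]even_mapE !rmorph1.
rewrite [LHS]even_mapE [RHS](rmorphM \val) /= -[RHS]/(even_val (even_map x) * even_val (even_map y)).
by rewrite !even_mapE -rmorphM.
Qed.
HB.instance Definition _ := GRing.isZmodMorphism.Build _ _ even_map even_map_zmod.
HB.instance Definition _ := GRing.isMonoidMorphism.Build _ _ even_map even_map_monoid.

Lemma even_map_proj x : even_map (even_proj x) = even_proj (f x).
Proof. by apply/val_inj; rewrite /= sh_ev cevK. Qed.

End EvenMap.

(** [Fg'h] and [Fgh'] stand for W(gh, l) and W(g, hl). The relation is multiplied on the right by
    N(ghl)^-1 before taking traces: [Nl] cancels against [Nl'], and cyclicity of the trace brings
    [Ng'] next to [Ng]. *)
Lemma trace_cocycle (R : comNzRingType) (m : nat) (Fgh Fgh' Fg'h Fhl : 'M[R]_m)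
  (Ng Nl Ng' Nh' Nl' : 'M[R]_m) : Ng' *m Ng = 1%:M -> Nl *m Nl' = 1%:M ->
  Fg'h + Fgh *m Nl = Fgh' + Ng *m Fhl ->
  \tr (Fhl *m (Nl' *m Nh')) - \tr (Fg'h *m (Nl' *m (Nh' *m Ng')))
  + \tr (Fgh' *m (Nl' *m Nh' *m Ng')) - \tr (Fgh *m (Nh' *m Ng')) = 0.
Proof.
move=> Vg lV /(congr1 (fun T => \tr (T *m (Nl' *m (Nh' *m Ng'))))).
rewrite !mulmxDl !mxtraceD -!mulmxA (mulmxA Nl) lV mul1mx [X in _ = _ + X]mxtrace_mulC.
rewrite -!mulmxA Vg mulmx1 => E.
set c := \tr (Fgh' *m _) in E *; set d := \tr (Fhl *m _) in E *.
by rewrite -(subrr (c + d)) -[in X in _ = _ - X]E; ring.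
Qed.

Section Cocycle.
Variables (k : fieldType) (p m n : nat).
Hypothesis charp : p \in [pchar k].

Section Points.
Variable A : csalg k.
Local Notation A0 := (even_part A).
Local Notation pt := (GLpt m n A).
Implicit Types (g h l : pt) (X Y Z : 'M[A]_(m + n)).

Local Notation ix := (@lshift m n).
Local Notation charA := (even_pchar A charp).

Definition frob X : 'M[A0]_m := \matrix_(i, j) even_proj (X (ix i) (ix j)) ^+ p.

(** The matrix W(g, h). The summands with [s] odd are products of two odd entries: they disappear
    from [frob (X *m Y)] but not from here, and the detection of the class rests on one of them. *)
Definition teich X Y : 'M[A0]_m :=
  \matrix_(i, j) witt p (fun s => even_proj (X (ix i) s * Y s (ix j))).

Lemma par_ix i : par (ix i) = false.
Proof. by rewrite /par /= leqNgt ltn_ord. Qed.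

Lemma par_rshift (i : 'I_n) : par (rshift m i) = true.
Proof. by rewrite /par /= leq_addr. Qed.

Lemma even_entry X Y i s j : even_smx X -> even_smx Y ->
  homog (cev A) false (X (ix i) s * Y s (ix j)).
Proof.
by move=> hX hY; have := cevM (hX (ix i) s) (hY s (ix j)); rewrite !par_ix addbF addbb.
Qed.

Lemma even_projM x y : homog (cev A) false x -> homog (cev A) false y ->
  even_proj (x * y) = even_proj x * even_proj y.
Proof.
by move=> hx hy; apply/val_inj; rewrite /= (cevM hx hy) hx hy.
Qed.

Hypothesis p_gt2 : (2 < p)%N.

Lemma odd_sqr (x : A) : homog (cev A) true x -> x * x = 0.
Proof.
move=> hx; have := cevC hx hx; rewrite expr1 mulN1r => /eqP.
rewrite -addr_eq0 -mulr2n -scaler_nat scaler_eq0 => /orP[|/eqP //].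
by rewrite -(dvdn_pcharf charp) => /(@dvdn_leq p 2 isT); rewrite leqNgt p_gt2.
Qed.

Lemma odd_mul_sqr x y y' : homog (cev A) true x -> homog (cev A) true y' -> 
  (y * x) * (y' * x) = 0.
Proof.
move=> hx hy'; rewrite -mulrA (mulrA x) (cevC hx hy') expr1 mulN1r mulNr mulrN.
by rewrite -mulrA odd_sqr // !mulr0 oppr0.
Qed.

Lemma odd_mul_sqrl x y y' : homog (cev A) true x -> homog (cev A) true y -> 
  (x * y) * (x * y') = 0.
Proof.
move=> hx hy; rewrite mulrA -(mulrA x) (cevC hy hx) expr1 mulN1r mulrN mulNr.
by rewrite mulrA odd_sqr // !mul0r oppr0.
Qed.

Lemma even_proj_mul0 x y : homog (cev A) false x -> homog (cev A) false y ->
  x * y = 0 -> even_proj x * even_proj y = 0.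
Proof. by move=> hx hy xy; rewrite -even_projM // xy raddf0. Qed.

Lemma odd_rentry X i (t : 'I_n) : even_smx X -> homog (cev A) true (X (ix i) (rshift m t)).
Proof. by move=> hX; have := hX (ix i) (rshift m t); rewrite par_ix par_rshift. Qed.
Lemma odd_lentry X i (t : 'I_n) : even_smx X -> homog (cev A) true (X (rshift m t) (ix i)).
Proof. by move=> hX; have := hX (rshift m t) (ix i); rewrite par_ix par_rshift. Qed.

(** Frobenius is additive on the even part. A product of two odd entries has square 0, hence [p]-th
    power 0, so only the even intermediate indices contribute. *)
Lemma frobM X Y : even_smx X -> even_smx Y -> frob (X *m Y) = frob X *m frob Y.
Proof.
move=> hX hY; apply/matrixP => i j; rewrite !mxE raddf_sum -(pFrobenius_autE charA).
rewrite rmorph_sum big_split_ord /= [X in _ + X]big1 ?addr0 => [|t _].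
  apply: eq_bigr => s _; rewrite !mxE pFrobenius_autE even_projM ?exprMn //.
  - by have := hX (ix i) (ix s); rewrite !par_ix.
  - by have := hY (ix s) (ix j); rewrite !par_ix.
rewrite pFrobenius_autE; case: p p_gt2 => [|[|q]] // _; rewrite !exprS mulrA.
rewrite even_proj_mul0 ?mul0r //; try exact: even_entry.
by apply: odd_mul_sqrl; [exact: odd_rentry|exact: odd_lentry].
Qed.

Lemma frob1 : frob 1%:M = 1%:M.
Proof.
apply/matrixP => i j; rewrite !mxE (inj_eq (@lshift_inj m n)).
have -> : even_proj (i == j)%:R = (i == j)%:R :> A0.
  apply/val_inj; rewrite rmorph_nat /=; case: eqP => _; first exact: cev1.
  exact: linear0.
by case: eqP => _; rewrite ?expr1n // expr0n; case: p p_gt2.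
Qed.

(** This is [witt_exchange] for the triple products [u s t]. With an even outer index the common
    entry comes out as its [p]-th power, giving [frob]; with an odd one all members share an odd
    factor, their pairwise products vanish, and so does [witt]. *)
Lemma teich_cocycle X Y Z : even_smx X -> even_smx Y -> even_smx Z ->
  teich (X *m Y) Z + teich X Y *m frob Z = teich X (Y *m Z) + frob X *m teich Y Z.
Proof.
move=> hX hY hZ; apply/matrixP => i j; rewrite !mxE.
pose u s t := even_proj (X (ix i) s * Y s t * Z t (ix j)).
have [hXY hYZ] : even_smx (X *m Y) /\ even_smx (Y *m Z) by split; apply: even_smxM.
transitivity (witt p (fun t => \sum_s u s t) + \sum_t witt p (u^~ t)).
  apply: (congr2 +%R).
    apply: eq_witt => t; rewrite mxE mulr_suml raddf_sum; exact: eq_bigr.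
  rewrite [RHS]big_split_ord /= [X in _ + X]big1 ?addr0 => [|t _].
    apply: eq_bigr => t _; rewrite !mxE mulrC -wittZ; apply: eq_witt => s.
    rewrite mulrC [RHS]even_projM //; first exact: even_entry.
    by have := hZ (ix t) (ix j); rewrite !par_ix.
  have hXYst s : homog (cev A) true (X (ix i) s * Y s (rshift m t)).
    have := cevM (hX (ix i) s) (hY s (rshift m t)).
    by rewrite par_ix par_rshift addbA addbK.
  apply: (witt_square_zero charA) => s s'; apply: even_proj_mul0.
  - exact: (cevM (hXYst s) (odd_lentry _ _ hZ)).
  - exact: (cevM (hXYst s') (odd_lentry _ _ hZ)).
  - by apply: odd_mul_sqr => //; apply: odd_lentry.
rewrite -(witt_exchange charA); apply: (congr2 +%R).
  apply: eq_witt => s; rewrite mxE mulr_sumr raddf_sum; apply: eq_bigr => t _.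
  by rewrite /u mulrA.
rewrite big_split_ord /= [X in _ + X]big1 ?addr0 => [|s _].
  apply: eq_bigr => s _; rewrite !mxE -wittZ; apply: eq_witt => t.
  rewrite /u -mulrA [LHS]even_projM //; last exact: even_entry.
  by have := hX (ix i) (ix s); rewrite !par_ix.
have hYZst t : homog (cev A) true (Y (rshift m s) t * Z t (ix j)).
  have := cevM (hY (rshift m s) t) (hZ t (ix j)).
  by rewrite par_ix par_rshift addbA addbK.
apply: (witt_square_zero charA) => t t'; rewrite /u -!mulrA; apply: even_proj_mul0.
- exact: (cevM (odd_rentry _ _ hX) (hYZst t)).
- exact: (cevM (odd_rentry _ _ hX) (hYZst t')).
- by apply: odd_mul_sqrl => //; apply: odd_rentry.
Qed.

Definition cocycle g h : A :=
  even_val (\tr (teich (gmx g) (gmx h) *m frob (ginv h *m ginv g))).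

Lemma cocycleP g h l :
  cocycle h l - cocycle (GLmul g h) l + cocycle g (GLmul h l) - cocycle g h = 0.
Proof.
have e1 := gmx_even g; have e2 := gmx_even h; have e3 := gmx_even l.
have i1 := ginv_even g; have i2 := ginv_even h; have i3 := ginv_even l.
have Vg : frob (ginv g) *m frob (gmx g) = 1%:M by rewrite -frobM // gVmx frob1.
have lV : frob (gmx l) *m frob (ginv l) = 1%:M by rewrite -frobM // gmxV frob1.
have := trace_cocycle (frob (ginv h)) Vg lV (teich_cocycle e1 e2 e3).
rewrite -!frobM //; try exact: even_smxM.
move=> /(congr1 \val); rewrite rmorph0 raddfB raddfD raddfB; exact.
Qed.

End Points.

(** Naturality allows the cocycle to be formed once, at the universal pair of points, and then
    specialised. *)
Lemma cocycle_map (A B : csalg k) (f : shom A B) (g h : GLpt m n A) :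
  cocycle (GLmap f g) (GLmap f h) = f (cocycle g h).
Proof.
rewrite /cocycle -even_mapE; congr even_val; rewrite rmorph_sum; apply: eq_bigr => i _.
rewrite !mxE rmorph_sum; apply: eq_bigr => j _; rewrite rmorphM /=; apply: (congr2 *%R).
  rewrite !mxE rmorph_witt; apply: eq_witt => s.
  by rewrite /= even_map_proj !mxE rmorphM.
rewrite !mxE rmorphXn /= even_map_proj rmorph_sum /=.
by congr (even_proj _ ^+ _); apply: eq_bigr => s _; rewrite !mxE rmorphM.
Qed.
End Cocycle.

(** * Linear retractions and the comultiplication on points *)

Definition linear_of (k : fieldType) (V W : lmodType k) (f : V -> W)
  (f_lin : linear f) : {linear V -> W} :=
  HB.pack_for {linear V -> W} f (GRing.isLinear.Build k V W _ f f_lin).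

Lemma sub_linear (k : fieldType) (V W : lmodType k) (f g : {linear V -> W}) :
  linear (fun x => f x - g x).
Proof. by move=> a x y; rewrite (linearP f) (linearP g) scalerBr opprD addrACA. Qed.

Lemma add_linear (k : fieldType) (V W : lmodType k) (f g : {linear V -> W}) :
  linear (fun x => f x + g x).
Proof. by move=> a x y; rewrite (linearP f) (linearP g) scalerDr addrACA. Qed.

(** The kernel of the retraction is a complement of the image of [i], obtained by Zorn's lemma as a
    maximal set closed under combinations and meeting the image at most in 0. *)
Lemma linear_retraction (k : fieldType) (M N : lmodType k) (i : {linear M -> N}) :
  injective i -> exists r : {linear N -> M}, cancel i r.
Proof.
move=> inj_i.
pose P (X : set N) := (forall a x y, X x -> X y -> X (a *: x + y)) /\
  forall v, X (i v) -> v = 0.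
have [X [[Xlin Xi] Xmax]] : exists X, P X /\ forall Y, (X `<` Y)%classic -> ~ P Y.
  apply: Zorn_bigcup => F FP Ftot; split=> [a x y [Y FY Yx] [Z FZ Zy]|v [Y FY]].
    have [YZ|ZY] := Ftot _ _ FY FZ.
    - by exists Z => //; apply: (FP _ FZ).1 => //; apply: YZ.
    - by exists Y => //; apply: (FP _ FY).1 => //; apply: ZY.
  exact: (FP _ FY).2.
(* [P] cannot demand that 0 be a member, since the union of the empty chain is empty; 0 is added
   here. *)
pose X0 x := X x \/ x = 0.
have X0lin a x y : X0 x -> X0 y -> X0 (a *: x + y).
  have X0Z b z : X z -> X0 (b *: z).
    move=> Xz; left; have := Xlin (b - 1) z z Xz Xz.
    by rewrite scalerBl scale1r subrK.
  case=> [Xx|->]; last by rewrite scaler0 add0r.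
  case=> [Xy|->]; first by left; apply: Xlin.
  by rewrite addr0; apply: X0Z.
have X0i v : X0 (i v) -> v = 0.
  by case=> [/Xi //|iv0]; apply: inj_i; rewrite iv0 linear0.
(* Otherwise the span [Y] of [X0] and [x] would be larger: a relation [i v = z + b *: x] with [b]
   nonzero can be solved for [x], which gives the decomposition after all. *)
have split_ex x : exists v, X0 (x - i v).
  apply: contrapT => nx; pose Y : set N := [set y | exists b z, X0 z /\ y = z + b *: x]%classic.
  apply: (Xmax Y).
    split=> [y Xy|/(_ x) YX]; first by exists 0, y; split; [left|rewrite scale0r addr0].
    apply: nx; exists 0; left; rewrite linear0 subr0; apply: YX.
    by exists 1, 0; split; [right|rewrite scale1r add0r].
  split=> [a _ _ [b [z [Xz ->]]] [b' [z' [Xz' ->]]]|v [b [z [Xz e]]]].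
    exists (a * b + b'), (a *: z + z'); split; first exact: X0lin.
    by rewrite scalerDr scalerDl scalerA addrACA.
  case: (eqVneq b 0) => [b0|nb]; first by apply: X0i; rewrite e b0 scale0r addr0.
  case: nx; exists (b^-1 *: v); rewrite linearZ /= e scalerDr scalerA mulVf // scale1r.
  rewrite opprD addrCA subrr addr0 -scaleNr -[_ *: z]addr0.
  by apply: X0lin => //; right.
have [r rP] := choice split_ex.
have uniq x v w : X0 (x - i v) -> X0 (x - i w) -> v = w.
  move=> hv hw; apply/eqP; rewrite -subr_eq0; apply/eqP/X0i.
  have := X0lin (-1) _ _ hv hw.
  by rewrite scaleN1r opprB addrA subrK linearB.
have r_lin : linear r.
  move=> a x y; apply: (uniq (a *: x + y)) => //.
  by rewrite linearP opprD addrACA -scalerBr; apply: X0lin.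
exists (linear_of r_lin) => v; apply: (uniq (i v)) => //=.
by rewrite subrr; right.
Qed.

(** * Maps out of tensor products of superalgebras *)

Section TensorMaps.
Variable k : fieldType.
Implicit Types U V W : lmodType k.

Lemma tens_linear_ext V W U (f g : {linear tens V W -> U}) :
  (forall v w, f (v \tp w) = g (v \tp w)) -> f =1 g.
Proof.
move=> fg; elim/tens_ind => [|x y hx hy|//]; first by rewrite !linear0.
by rewrite !linearD hx hy.
Qed.

Definition tlift_lin V W U (b : V -> W -> U) (hb : bilin b) : {linear tens V W -> U} :=
  linear_of (tlift_linear hb).

(** Linear retractions of the unit maps of [A] and [B] multiply to a bilinear form with value 1 at
    (1, 1); a general algebra need not have a counit to serve instead. *)
Lemma tone_neq0 (A B : csalg k) : tone A B != 0.
Proof.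
have fct (D : csalg k) : exists r : {linear D -> k^o}, r 1 = 1.
  have ilin : linear (fun a : k^o => a%:A : D).
    by move=> a u v; rewrite scalerDl scalerA.
  have [|r rK] := @linear_retraction k _ _ (linear_of ilin).
    move=> a b /= /eqP; rewrite -subr_eq0 -scalerBl scaler_eq0 oner_eq0 orbF.
    by rewrite subr_eq0 => /eqP.
  by exists r; rewrite -[RHS]rK /= scale1r.
have [[f f1] [g g1]] := (fct A, fct B).
have hb : bilin (fun a b => f a * g b : k^o).
  split=> [a|b] s u v /=; rewrite linearP /=; first by rewrite mulrDr scalerAr.
  by rewrite mulrDl scalerAl.
apply/eqP => h; have := tlift_pure 1 1 hb.
rewrite -[1 \tp 1]/(tone A B) h (tlift_0 hb) f1 g1 mulr1 => /eqP.
by rewrite eq_sym oner_eq0.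
Qed.

Section Copair.
Variables (A B E : csalg k) (nz : tone A B != 0) (f : shom A E) (g : shom B E).
Local Notation AB := (tens_csalg nz).

Definition copair (x : AB) : E := tlift (fun a b => f a * g b) x.

Lemma copair_bilin : bilin (fun (a : A) (b : B) => f a * g b).
Proof.
split=> [a|b] s u v /=; rewrite linearP; first by rewrite mulrDr -scalerAr.
by rewrite mulrDl -scalerAl.
Qed.

Lemma copair_pure a b : copair (a \tp b) = f a * g b.
Proof. exact: (tlift_pure _ _ copair_bilin). Qed.

Lemma copair_linear : linear copair.
Proof. exact: (tlift_linear copair_bilin). Qed.
HB.instance Definition _ := GRing.isLinear.Build k AB E _ copair copair_linear.

(** The sign in the product of the tensor algebra is the one produced by exchanging [g b] and [f c]
    in the supercommutative algebra [E]. *)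
Lemma copair_monoid : monoid_morphism copair.
Proof.
split=> [|x y]; first by rewrite [LHS]copair_pure !rmorph1 mulr1.
elim/(tens_homog_ind (@cevK k A) (@cevK k B)): x => [|x x' hx hx'|pa pb a b ha hb].
- by rewrite mul0r linear0 mul0r.
- by rewrite mulrDl !linearD /= hx hx' mulrDl.
elim/(tens_homog_ind (@cevK k A) (@cevK k B)): y => [|y y' hy hy'|pc pd c d hc hd].
- by rewrite mulr0 linear0 mulr0.
- by rewrite mulrDr !linearD /= hy hy' mulrDr.
have -> : (a \tp b : AB) * (c \tp d) = _ := tmul_pure a d hb hc.
rewrite linearZ /= !copair_pure !rmorphM /= -!mulrA (mulrA (g b)).
rewrite [g b * f c](cevC (homog_shom g hb) (homog_shom f hc)).
by rewrite -!mulrA mulr_sign -scaler_sign -scalerAr !mulrA.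
Qed.
HB.instance Definition _ := GRing.isMonoidMorphism.Build AB E copair copair_monoid.

Lemma copair_ev x : copair (cev AB x) = cev E (copair x).
Proof.
elim/(tens_homog_ind (@cevK k A) (@cevK k B)): x => [|x x' hx hx'|pa pb a b ha hb].
- by rewrite !linear0.
- by rewrite !linearD /= hx hx'.
rewrite copair_pure (cevM (homog_shom f ha) (homog_shom g hb)).
have -> : cev AB (a \tp b) = _ := tev_pure ha hb.
by case: (_ (+) _); rewrite ?linear0 ?copair_pure.
Qed.
Definition copair_shom : shom AB E := @Shom k AB E copair copair_ev.

End Copair.
End TensorMaps.

(** * Tensors as functions of several points *)

Section Points.
Variables (k : fieldType) (m n : nat).
Local Notation C := (coordGL k m n).
Local Notation gen := (cgen k m n).

(** The stored inverse is determined by the matrix, so points need only be compared on their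
    matrices. *)
Lemma ceval_ext (A : csalg k) (g h : GLpt m n A) : gmx g = gmx h -> ceval g =1 ceval h.
Proof.
by move=> gh; apply: (@coordGL_unique _ _ _ _ (ceval_shom g) (ceval_shom h)); rewrite !coordGL_exists.
Qed.

Lemma ceval_map (A B : csalg k) (f : shom A B) (g : GLpt m n A) x :
  f (ceval g x) = ceval (GLmap f g) x.
Proof.
rewrite /ceval; elim: (repr x) => [c|i j|i j|s hs t ht|s hs t ht] /=.
- by rewrite linearZ rmorph1.
- by rewrite mxE.
- by rewrite mxE.
- by rewrite linearD /= hs ht.
- by rewrite rmorphM /= hs ht.
Qed.

Lemma ceval_cgen x : ceval gen x = x.
Proof.
apply: coord_ext => A g; rewrite [LHS](ceval_map (ceval_shom g)).
exact/ceval_ext/coordGL_exists.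
Qed.

Lemma map_cgen (A : csalg k) (f : shom C A) x : ceval (GLmap f gen) x = f x.
Proof. by rewrite -ceval_map ceval_cgen. Qed.

Section Unit.
Variable A : csalg k.

Definition unit_map (a : ground k) : A := a *: 1.
Lemma unit_map_linear : linear unit_map.
Proof. by move=> a u v; rewrite /unit_map scalerDl scalerA. Qed.
HB.instance Definition _ := GRing.isLinear.Build k (ground k) A _ unit_map unit_map_linear.
Lemma unit_map_monoid : monoid_morphism unit_map.
Proof.
split=> [|x y]; first exact: scale1r.
by rewrite /unit_map -scalerAl mul1r scalerA.
Qed.
HB.instance Definition _ :=
  GRing.isMonoidMorphism.Build (ground k) A unit_map unit_map_monoid.
Lemma unit_map_ev a : unit_map (cev (ground k) a) = cev A (unit_map a).
Proof. by rewrite /unit_map linearZ /= (cev1 A). Qed.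
Definition unit_shom : shom (ground k) A := @Shom k (ground k) A unit_map unit_map_ev.

Lemma ceval_one x : ceval (GLone m n A) x = counit x *: 1.
Proof.
rewrite -[RHS]/(unit_shom (counit x)) /counit ceval_map; apply: ceval_ext.
by apply/matrixP => i j; rewrite !mxE rmorph_nat.
Qed.
End Unit.

Section Eval2.
Variables (A : csalg k) (g h : GLpt m n A).

(** Reads a tensor as a function of two points. Hopf algebra identities then become group identities
    evaluated at universal points. *)
Definition eval2 : tens C C -> A := tlift (fun x y => ceval g x * ceval h y).

Local Notation ev := (copair_shom (tone_coord_neq0 k m n) (ceval_shom g) (ceval_shom h)).

Lemma eval2_pure x y : eval2 (x \tp y) = ceval g x * ceval h y.
Proof. exact: (copair_pure (tone_coord_neq0 k m n) (ceval_shom g) (ceval_shom h)). Qed.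

Lemma eval2_linear : linear eval2.
Proof. exact: (tlift_linear (copair_bilin (ceval_shom g) (ceval_shom h))). Qed.
HB.instance Definition _ := GRing.isLinear.Build k _ A _ eval2 eval2_linear.

Lemma eval2_comul x : eval2 (comul x) = ceval (GLmul g h) x.
Proof.
rewrite -[LHS]/(ev (comul x)) /comul ceval_map; apply: ceval_ext.
apply/matrixP => i j; rewrite !mxE [LHS]rmorph_sum; apply: eq_bigr => s _.
rewrite !mxE [LHS]rmorphM [X in X * _](copair_pure _ (ceval_shom g)).
rewrite [X in _ * X](copair_pure _ _ (ceval_shom h)) /= !rmorph1 mulr1 mul1r.
by rewrite !ceval_pi.
Qed.
End Eval2.

Lemma eq_tlift (V W : lmodType k) (U : nmodType) (b b' : V -> W -> U) :
  b =2 b' -> tlift b =1 tlift b'.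
Proof. by move=> bb x; apply: eq_bigr => p _; apply: bb. Qed.

(** At the universal point this is x(g 1) = x(g). *)
Lemma comul_counit (x : C) : tlift (fun c c' : C => counit c' *: c) (comul x) = x.
Proof.
transitivity (eval2 gen (GLone m n C) (comul x)).
  by apply: eq_tlift => c c'; rewrite ceval_cgen ceval_one -scalerAr mulr1.
rewrite eval2_comul -[RHS]ceval_cgen; apply: ceval_ext; exact: mulmx1.
Qed.

Lemma comul_counitl (x : C) : tlift (fun c c' : C => counit c *: c') (comul x) = x.
Proof.
transitivity (eval2 (GLone m n C) gen (comul x)).
  by apply: eq_tlift => c c'; rewrite ceval_cgen ceval_one -scalerAl mul1r.
rewrite eval2_comul -[RHS]ceval_cgen; apply: ceval_ext; exact: mul1mx.
Qed.

Section Triple.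
Local Notation CC := (tens_csalg (tone_neq0 C C)).
Local Notation i1 := (tinl_shom (tone_neq0 C CC)).
Local Notation i2 := (tinr_shom (tone_neq0 C CC)).
Local Notation j1 := (tinl_shom (tone_neq0 C C)).
Local Notation j2 := (tinr_shom (tone_neq0 C C)).

(** [gen1], [gen2] and [gen3] form the universal triple of points, over the threefold tensor product
    bracketed as in [coact_comul]. *)
Definition gen1 := GLmap i1 gen.
Definition gen2 := GLmap i2 (GLmap j1 gen).
Definition gen3 := GLmap i2 (GLmap j2 gen).

Lemma tinl_tinr (A B : csalg k) (nz : tone A B != 0) (a : A) (b : B) :
  tinl_shom nz a * tinr_shom nz b = a \tp b.
Proof.
have := tmul_pure a b (cev1 B) (cev1 A).
by rewrite /= expr0 scale1r mulr1 mul1r.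
Qed.

Lemma ceval_gen1 c : ceval gen1 c = i1 c.
Proof. exact: map_cgen. Qed.
Lemma ceval_gen2 c : ceval gen2 c = i2 (j1 c).
Proof. by rewrite -ceval_map map_cgen. Qed.
Lemma ceval_gen3 c : ceval gen3 c = i2 (j2 c).
Proof. by rewrite -ceval_map map_cgen. Qed.

Lemma eval_gen23 t : eval2 gen2 gen3 t = i2 t.
Proof.
apply: (tens_linear_ext (f := eval2 gen2 gen3) (g := i2)) => d d'.
by rewrite [LHS]eval2_pure ceval_gen2 ceval_gen3 -rmorphM /= tinl_tinr.
Qed.

Lemma eval_gen1_23 (c : C) (t : tens C C) : ceval gen1 c * eval2 gen2 gen3 t = c \tp t.
Proof. by rewrite eval_gen23 ceval_gen1; exact: tinl_tinr. Qed.

Lemma assocr_bilin (c : C) : bilin (fun d d' : C => d \tp (d' \tp c)).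
Proof.
split=> [u a v w|u a v w]; last exact: (bilin_pure _ _).2.
by rewrite ((bilin_pure C C).2 c) ((bilin_pure C (tens C C)).1 u).
Qed.

Lemma eval_gen12_3 (c : C) (t : tens C C) :
  eval2 gen1 gen2 t * ceval gen3 c = tlift (fun d d' : C => d \tp (d' \tp c)) t.
Proof.
have lin : linear (fun t => eval2 gen1 gen2 t * ceval gen3 c).
  by move=> a u v; rewrite linearP mulrDl scalerAl.
apply: (tens_linear_ext (f := linear_of lin) (g := tlift_lin (assocr_bilin c))) => d d'.
rewrite /= (tlift_pure _ _ (assocr_bilin c)) eval2_pure ceval_gen1 ceval_gen2 ceval_gen3.
by rewrite -mulrA -rmorphM /= !tinl_tinr.
Qed.
End Triple.

(** Both sides are the value of [x] at the product of the universal triple, bracketed in the two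
    possible ways. *)
Lemma comul_assoc (x : C) :
  tlift (fun c c' : C => tlift (fun d d' : C => d \tp (d' \tp c')) (comul c)) (comul x)
  = tlift (fun c c' : C => c \tp comul c') (comul x).
Proof.
transitivity (eval2 (GLmul gen1 gen2) gen3 (comul x)).
  by apply: eq_tlift => c c'; rewrite -eval2_comul eval_gen12_3.
transitivity (eval2 gen1 (GLmul gen2 gen3) (comul x)).
  rewrite !eval2_comul.
  have E : gmx (GLmul (GLmul gen1 gen2) gen3) = gmx (GLmul gen1 (GLmul gen2 gen3)).
    exact: (esym (mulmxA _ _ _)).
  exact: (ceval_ext E x).
by apply: eq_tlift => c c'; rewrite -eval2_comul eval_gen1_23.
Qed.

Lemma comul_ev (x : C) : comul (cev C x) = tev (cev C) (cev C) (comul x).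
Proof.
pose nz := tone_coord_neq0 k m n.
exact: (ceval_ev (GLmul (GLmap (tinl_shom nz) gen) (GLmap (tinr_shom nz) gen)) x).
Qed.

Lemma counit_ev (x : C) : counit (cev C x) = counit x.
Proof. exact: (ceval_ev (GLone m n (ground k)) x). Qed.

End Points.

(** * Cofree supermodules and the cobar resolution *)

Section Lift.
Variables (k : fieldType) (V W : lmodType k).

Lemma linear_tlift (U U' : lmodType k) (g : {linear U -> U'}) (b : V -> W -> U) x :
  g (tlift b x) = tlift (fun v w => g (b v w)) x.
Proof. exact: linear_sum. Qed.

Lemma tlift_tlift (V' W' U : lmodType k) (b : V' -> W' -> U) (b' : V -> W -> tens V' W') x :
  bilin b -> tlift b (tlift b' x) = tlift (fun v w => tlift b (b' v w)) x.
Proof. move=> hb; exact: (linear_tlift (tlift_lin hb)). Qed.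

Lemma tlift_param (X U : lmodType k) (b : X -> V -> W -> U) t :
  (forall v w, linear (fun x => b x v w)) -> linear (fun x => tlift (b x) t).
Proof.
move=> hb a x y; rewrite /tlift /tsum scaler_sumr -big_split.
by apply: eq_bigr => p _; apply: hb.
Qed.

Lemma tpure_linearr (v : V) : linear (tpure v : W -> tens V W).
Proof. exact: (bilin_pure V W).1. Qed.
Lemma tpure_linearl (w : W) : linear (fun v : V => v \tp w).
Proof. exact: (bilin_pure V W).2. Qed.
End Lift.

Section Cofree.
Variables (k : fieldType) (m n : nat).
Local Notation C := (coordGL k m n).
Variable V : superspace k.

(** Rebracketing, needed because [comul] yields a tensor in [tens C C] while a coaction on
    [tens V C] must keep its new factor outermost. *)
Definition tassoc (v : V) : tens C C -> tens (tens V C) C :=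
  tlift (fun c c' : C => (v \tp c) \tp c').

Lemma tassoc_bilin (v : V) : bilin (fun c c' : C => (v \tp c) \tp c').
Proof.
split=> [c|c'] a x y; first by rewrite tpure_linearr.
by rewrite tpure_linearr tpure_linearl.
Qed.

Lemma tassoc_pure v c c' : tassoc v (c \tp c') = (v \tp c) \tp c'.
Proof. exact: (tlift_pure _ _ (tassoc_bilin v)). Qed.

Lemma tassoc_linear v : linear (tassoc v).
Proof. exact: (tlift_linear (tassoc_bilin v)). Qed.
HB.instance Definition _ v := GRing.isLinear.Build k _ _ _ (tassoc v) (tassoc_linear v).

Definition cofree_coact : tens V C -> tens (tens V C) C :=
  tlift (fun (v : V) (c : C) => tassoc v (comul c)).

Lemma cofree_coact_bilin : bilin (fun (v : V) (c : C) => tassoc v (comul c)).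
Proof.
split=> [v|c] a x y; first by rewrite comul_linear linearP.
apply: (@tlift_param _ _ _ V _ (fun v c c' => (v \tp c) \tp c')) => {}c c' {}a {}x {}y.
by rewrite tpure_linearl tpure_linearl.
Qed.

Lemma cofree_coact_pure v (c : C) : cofree_coact (v \tp c) = tassoc v (comul c).
Proof. exact: (tlift_pure _ _ cofree_coact_bilin). Qed.

Lemma cofree_coact_linear : linear cofree_coact.
Proof. exact: (tlift_linear cofree_coact_bilin). Qed.
HB.instance Definition _ := GRing.isLinear.Build k _ _ _ cofree_coact cofree_coact_linear.

Lemma tassoc_homog b c v t : homog (ev V) b v -> homog (tev (cev C) (cev C)) c t ->
  homog (tev (tev (ev V) (cev C)) (cev C)) (b (+) c) (tassoc v t).
Proof.
(* Summands of a homogeneous tensor need not be homogeneous, so the induction runs over arbitrary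
   tensors, replaced by their component of parity [c]. *)
move=> hv ht; have <- : part (tev (cev C) (cev C)) c t = t.
  by rewrite (part_id ht) eqxx.
elim/(tens_homog_ind (@cevK k C) (@cevK k C)): t {ht} => [|x y hx hy|bc bd x y hx hy].
- have -> : part (tev (cev C) (cev C)) c 0 = 0.
    by rewrite /part; case: c; rewrite linear0 ?subr0.
  rewrite linear0; exact: homog0.
- have -> : part (tev (cev C) (cev C)) c (x + y)
      = part (tev (cev C) (cev C)) c x + part (tev (cev C) (cev C)) c y.
    by have := part_linear (tev (cev C) (cev C)) c 1 x y; rewrite !scale1r.
  by rewrite linearD; apply: homogD.
rewrite (part_id (tev_pure hx hy)); case: eqP => [<-|_]; last first.
  by rewrite linear0; apply: homog0.
by rewrite tassoc_pure addbA; apply: tev_pure => //; apply: tev_pure.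
Qed.

Lemma cofree_coact_ev x :
  cofree_coact (tev (ev V) (cev C) x)
  = tev (tev (ev V) (cev C)) (cev C) (cofree_coact x).
Proof.
elim/(tens_homog_ind (@evK k V) (@cevK k C)): x => [|x y hx hy|b d v c hv hc].
- by rewrite !linear0.
- by rewrite !linearD /= hx hy.
have hd : homog (tev (cev C) (cev C)) d (comul c).
  rewrite /homog -comul_ev hc; case: (d) => //.
  exact: (linear0 (linear_of (@comul_linear k m n))).
have := tassoc_homog hv hd; rewrite /homog (tev_pure hv hc) cofree_coact_pure => ->.
by case: (_ (+) _); rewrite ?linear0 ?cofree_coact_pure.
Qed.

Lemma counit_scale_bilin (U : lmodType k) : bilin (fun (w : U) (c : C) => counit c *: w).
Proof.
split=> [w|c] a x y; first by rewrite counit_linear scalerDl scalerA.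
by rewrite scalerDr !scalerA mulrC.
Qed.

Lemma cofree_coact_counit x :
  tlift (fun (w : tens V C) (c : C) => counit c *: w) (cofree_coact x) = x.
Proof.
pose f := tlift_lin (counit_scale_bilin (tens V C)).
apply: (tens_linear_ext (f := f \o cofree_coact) (g := idfun)) => v c /=.
rewrite cofree_coact_pure tlift_tlift; last exact: counit_scale_bilin.
transitivity (tlift (fun c1 c2 : C => v \tp (counit c2 *: c1 : C)) (comul c)).
  by apply: eq_tlift => c1 c2; rewrite tlift_pure ?tpureZr //; apply: counit_scale_bilin.
rewrite -[in RHS](comul_counit c).
exact: (esym (linear_tlift (linear_of (@tpure_linearr k V C v)) _ _)).
Qed.

Lemma coassoc_bilin (U : lmodType k) (c : C) : bilin (fun (w : U) (c' : C) => w \tp (c' \tp c)).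
Proof.
split=> [w|c'] a x y; first by rewrite tpure_linearl tpure_linearr.
by rewrite tpure_linearl.
Qed.

Lemma coassoc_bilinl (U : lmodType k) (f : {linear U -> tens U C}) :
  bilin (fun (w : U) (c : C) => tlift (fun w' c' => w' \tp (c' \tp c)) (f w)).
Proof.
split=> [w|c] a x y; last by rewrite linearP; apply: (tlift_linear (coassoc_bilin U c)).
apply: (@tlift_param _ _ _ C _ (fun c w' c' => w' \tp (c' \tp c))) => w' c' {}a {}x {}y.
by rewrite !tpure_linearr.
Qed.

Lemma coassoc_bilinr (U : lmodType k) : bilin (fun (w : U) (c : C) => w \tp comul c).
Proof.
split=> [w|c] a x y; first by rewrite comul_linear tpure_linearr.
by rewrite tpure_linearl.
Qed.

Lemma cofree_coact_comul x :
  tlift (fun w (c : C) => tlift (fun w' (c' : C) => w' \tp (c' \tp c)) (cofree_coact w))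
    (cofree_coact x)
  = tlift (fun w (c : C) => w \tp comul c) (cofree_coact x).
Proof.
pose f := tlift_lin (coassoc_bilinl cofree_coact).
pose g := tlift_lin (coassoc_bilinr (tens V C)).
apply: (tens_linear_ext (f := f \o cofree_coact) (g := g \o cofree_coact)) => v c /=.
(* Applying this map to the coassociativity of [C] at [c] yields both sides at [v \tp c]. *)
have kb : bilin (fun (d : C) (y : tens C C) => (v \tp d) \tp y).
  split=> [d|y] a u w; first by rewrite tpure_linearr.
  by rewrite tpure_linearr tpure_linearl.
have := congr1 (tlift (fun (d : C) (y : tens C C) => (v \tp d) \tp y)) (comul_assoc c).
rewrite !(tlift_tlift _ _ kb) cofree_coact_pure /tassoc.
rewrite (tlift_tlift _ _ (coassoc_bilinl cofree_coact)).
rewrite (tlift_tlift _ _ (coassoc_bilinr (tens V C))) => E.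
transitivity (tlift (fun c1 c2 : C => tlift (fun (d : C) (y : tens C C) => (v \tp d) \tp y)
   (tlift (fun d d' : C => d \tp (d' \tp c2)) (comul c1))) (comul c)); last first.
  rewrite E; apply: eq_tlift => c1 c2.
  by rewrite (tlift_pure _ _ kb) (tlift_pure _ _ (coassoc_bilinr (tens V C))).
apply: eq_tlift => c1 c2; rewrite (tlift_pure _ _ (coassoc_bilinl cofree_coact)).
rewrite /= cofree_coact_pure (tlift_tlift _ _ kb) (tlift_tlift _ _ (coassoc_bilin (tens V C) c2)).
apply: eq_tlift => d1 d2.
by rewrite (tlift_pure _ _ kb) (tlift_pure _ _ (coassoc_bilin (tens V C) c2)).
Qed.

Definition cofree : supermodule k m n :=
  @Supermodule k m n (tens_superspace V (csalg_superspace C)) cofree_coact cofree_coact_ev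
    cofree_coact_counit cofree_coact_comul.

End Cofree.

(** With [e] the projections onto even parts, the even component [e r e + (1 - e) r (1 - e)] of a
    linear retraction [r] is again a retraction, because [i] is even. *)
Lemma even_retraction (k : fieldType) (M N : superspace k) (i : {linear M -> N}) :
  injective i -> (forall v, i (ev M v) = ev N (i v)) ->
  exists2 r : {linear N -> M}, cancel i r & forall x, r (ev N x) = ev M (r x).
Proof.
move=> inj_i i_ev; have [r rK] := linear_retraction inj_i.
pose g := linear_of (sub_linear (@idfun N) (ev N)).
pose r1 := linear_of (sub_linear (r \o g) (ev M \o r \o g)).
exists (linear_of (add_linear (ev M \o r \o ev N) r1)) => x /=.
  have e : i x - ev N (i x) = i (x - ev M x) by rewrite linearB i_ev.
  by rewrite e -i_ev !rK linearB /= !evK subrr subr0 addrC subrK.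
by rewrite evK subrr !linear0 !addr0 linearD linearB /= !evK subrr addr0.
Qed.

(** * Injectivity of cofree supermodules and exactness of the cobar complex *)

Section Resolution.
Variables (k : fieldType) (m n : nat).
Local Notation C := (coordGL k m n).
Local Notation smod := (supermodule k m n).

Section Functor.
Variables (V W : superspace k) (f : {linear V -> W}).

Lemma tmap_bilin : bilin (fun v (c : C) => f v \tp c).
Proof.
split=> [v|c] a x y; first by rewrite tpure_linearr.
by rewrite linearP tpure_linearl.
Qed.

Definition tmap : tens V C -> tens W C := tlift (fun v (c : C) => f v \tp c).

Lemma tmap_linear : linear tmap.
Proof. exact: (tlift_linear tmap_bilin). Qed.
HB.instance Definition _ := GRing.isLinear.Build k _ _ _ tmap tmap_linear.

Lemma tmap_pure v (c : C) : tmap (v \tp c) = f v \tp c.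
Proof. exact: (tlift_pure _ _ tmap_bilin). Qed.
End Functor.

Lemma tpure_tlift (V W : lmodType k) (U : lmodType k) (b : V -> W -> U) (c : C) x :
  tlift b x \tp c = tlift (fun v w => b v w \tp c) x.
Proof. exact: (linear_tlift (linear_of (@tpure_linearl k U C c))). Qed.

Lemma tlift_tpure (V W : lmodType k) (x : tens V W) : tlift (fun v w => v \tp w) x = x.
Proof. exact: (esym (tens_sum x)). Qed.

Lemma tmap_tlift (V W : superspace k) (X Y : lmodType k) (f : {linear V -> W})
  (b : X -> Y -> tens V C) x :
  tmap f (tlift b x) = tlift (fun v w => tmap f (b v w)) x.
Proof. exact: linear_tlift. Qed.

Lemma tmap_hom (V W : superspace k) (f : {linear V -> W}) :
  (forall v, f (ev V v) = ev W (f v)) ->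
  is_even_hom (M := cofree m n V) (N := cofree m n W) (tmap f).
Proof.
move=> f_ev; split=> [x|x].
  pose g := tlift_lin (tmap_bilin (V := cofree m n V) (W := cofree m n W) (tmap f)).
  apply: (tens_linear_ext (f := cofree_coact (V := W) \o tmap f)
    (g := g \o cofree_coact (V := V))) => v c /=.
  rewrite tmap_pure !cofree_coact_pure /tassoc.
  rewrite (tlift_tlift _ _ (tmap_bilin (V := cofree m n V) (W := cofree m n W) (tmap f))).
  apply: eq_tlift => c1 c2.
  rewrite (tlift_pure _ _ (tmap_bilin (V := cofree m n V) (W := cofree m n W) (tmap f))).
  by rewrite /= tmap_pure.
elim/(tens_homog_ind (@evK k V) (@cevK k C)): x => [|x y hx hy|b d v c hv hc].
- by rewrite !linear0.
- by rewrite !linearD /= hx hy.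
have hfv : homog (ev W) b (f v) by rewrite /homog -f_ev hv; case: (b); rewrite ?linear0.
rewrite /= (tev_pure hv hc) tmap_pure (tev_pure hfv hc).
by case: (_ (+) _); rewrite ?linear0 ?tmap_pure.
Qed.

(** Coassociativity of [M], rebracketed. *)
Lemma coact_hom (M : smod) : is_even_hom (M := M) (N := cofree m n M) (coact M).
Proof.
split; last exact: coact_ev.
move=> v; have ab : bilin (fun (w : M) (t : tens C C) => tassoc w t).
  split=> [w|t] a x y; first exact: linearP.
  apply: (@tlift_param _ _ _ M _ (fun v c c' => (v \tp c) \tp c')) => c c' {}a {}x {}y.
  by rewrite !tpure_linearl.
have := congr1 (tlift (fun (w : M) (t : tens C C) => tassoc w t)) (coact_comul v).
rewrite !(tlift_tlift _ _ ab) => E.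
transitivity (tlift (fun w c => tlift (fun (w : M) (t : tens C C) => tassoc w t)
  (w \tp comul c)) (coact M v)).
  by apply: eq_tlift => w c; rewrite (tlift_pure _ _ ab).
rewrite -E; apply: eq_tlift => w c; rewrite (tlift_tlift _ _ ab).
rewrite -[in RHS](tlift_tpure (coact M w)) tpure_tlift.
by apply: eq_tlift => w' c'; rewrite (tlift_pure _ _ ab) tassoc_pure.
Qed.

(** The counit of the adjunction between the forgetful functor and [cofree]; it also provides the
    contracting homotopy of the cobar complex. *)
Definition contr (V : superspace k) (x : cofree m n V) : V :=
  tlift (fun (w : V) (c : C) => counit c *: w) x.

Lemma contr_linear V : linear (@contr V).
Proof. exact: (tlift_linear (counit_scale_bilin m n V)). Qed.
HB.instance Definition _ V :=
  GRing.isLinear.Build k (cofree m n V) V _ (@contr V) (@contr_linear V).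

Lemma contr_pure (V : superspace k) (v : V) (c : C) : @contr V (v \tp c) = counit c *: v.
Proof. exact: (tlift_pure _ _ (counit_scale_bilin m n V)). Qed.

Lemma contr_coact (M : smod) (v : M) : @contr M (coact M v) = v.
Proof. exact: coact_counit. Qed.

Lemma contr_tmap (V W : superspace k) (f : {linear V -> W}) x :
  @contr W (tmap f x) = f (@contr V x).
Proof.
apply: (tens_linear_ext (f := @contr W \o tmap f) (g := f \o @contr V)) => v c /=.
by rewrite tmap_pure !contr_pure linearZ.
Qed.

Lemma contr_ev (V : superspace k) x : @contr V (tev (ev V) (cev C) x) = ev V (@contr V x).
Proof.
elim/(tens_homog_ind (@evK k V) (@cevK k C)): x => [|x y hx hy|b d v c hv hc].
- by rewrite !linear0.
- by rewrite !linearD /= hx hy.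
rewrite (tev_pure hv hc) contr_pure linearZ /= hv; case: d hc => hc.
  have c0 : counit c = 0 by rewrite -counit_ev hc; apply: (linear0 (linear_of (@counit_linear k m n))).
  by rewrite c0 scale0r; case: (b); rewrite /= ?linear0 // contr_pure c0 scale0r.
by rewrite addbF; case: (b); rewrite ?linear0 ?scaler0 ?contr_pure.
Qed.

Lemma tmap_contr (V : superspace k) (x : tens V C) : tmap (@contr V) (cofree_coact x) = x.
Proof.
apply: (tens_linear_ext (f := tmap (@contr V) \o cofree_coact (V := V)) (g := idfun)) => v c /=.
rewrite cofree_coact_pure /tassoc tmap_tlift.
transitivity (tlift (fun c1 c2 : C => v \tp (counit c1 *: c2 : C)) (comul c)).
  by apply: eq_tlift => c1 c2; rewrite tmap_pure /= contr_pure tpureZl tpureZr.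
rewrite -[in RHS](comul_counitl c).
exact: (esym (linear_tlift (linear_of (@tpure_linearr k V C v)) _ _)).
Qed.

Lemma tmap_tmap (U V W : superspace k) (f : {linear U -> V}) (g : {linear V -> W}) x :
  tmap g (tmap f x) = tlift (fun v (c : C) => g (f v) \tp c) x.
Proof.
by rewrite [X in tmap g X]/tmap tmap_tlift; apply: eq_tlift => v c; rewrite tmap_pure.
Qed.

Lemma hom_comp (M N P : smod) (f : {linear M -> N}) (g : {linear N -> P})
  (h : {linear M -> P}) : h =1 g \o f -> is_even_hom f -> is_even_hom g -> is_even_hom h.
Proof.
move=> hE [f_hom f_ev] [g_hom g_ev]; split=> v; rewrite !hE /=; last by rewrite f_ev g_ev.
rewrite g_hom f_hom (tlift_tlift _ _ (tmap_bilin (V := N) (W := P) g)).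
apply: eq_tlift => w c; rewrite hE.
exact: (tlift_pure _ _ (tmap_bilin (V := N) (W := P) g)).
Qed.

(** An even homomorphism into [cofree m n V] amounts to an even linear map into [V], its composite
    with [contr]; such a map extends along [i] by an even retraction. *)
Lemma cofree_injective (V : superspace k) : is_injective (cofree m n V).
Proof.
move=> M N i f [i_hom i_ev] inj_i [f_hom f_ev].
have [r rK r_ev] := even_retraction inj_i i_ev.
pose phi : {linear M -> V} := @contr V \o f.
pose psi : {linear N -> V} := phi \o r.
have phi_ev v : phi (ev M v) = ev V (phi v) by rewrite /= f_ev -contr_ev.
have psi_ev v : psi (ev N v) = ev V (psi v) by rewrite /psi /= r_ev; exact: phi_ev.
have g_lin : linear (fun x => tmap psi (coact N x)).
  by move=> a x y; rewrite !linearP.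
exists (linear_of g_lin : {linear N -> cofree m n V}); split.
  by apply: (hom_comp _ (coact_hom N) (tmap_hom psi_ev)).
move=> v /=; rewrite i_hom tmap_tlift -[RHS]tmap_contr.
have := f_hom v => /= ->.
rewrite tmap_tlift; apply: eq_tlift => w c.
by rewrite !tmap_pure /psi /= rK.
Qed.

Fixpoint cobar_mod (N : smod) (i : nat) : smod :=
  if i is j.+1 then cofree m n (cobar_mod N j) else N.

(** The alternating sum of the cofaces, up to a sign in each degree: the coaction comultiplies the
    last factor, and [tmap] of the previous differential contains the other cofaces. *)
Fixpoint cobar_diff (N : smod) (i : nat) : {linear cobar_mod N i -> cobar_mod N i.+1} :=
  match i with
  | 0 => coact N
  | j.+1 => linear_of (sub_linear (coact (cobar_mod N j.+1)) (tmap (cobar_diff N j)))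
  end.

Lemma tmapE (V W : superspace k) (f : {linear V -> W}) x :
  tlift (fun v (c : C) => f v \tp c) x = tmap f x.
Proof. by []. Qed.

Lemma tmap_sub (V W : superspace k) (f g : {linear V -> W}) x :
  tmap (linear_of (sub_linear f g)) x = tmap f x - tmap g x.
Proof.
rewrite /tmap /tlift /tsum -sumrB; apply: eq_bigr => q _.
by rewrite /= tpureDl -[- g _]scaleN1r tpureZl scaleN1r.
Qed.

Lemma sub_hom (M N : smod) (f g : {linear M -> N}) :
  is_even_hom f -> is_even_hom g -> is_even_hom (M := M) (N := N) (linear_of (sub_linear f g)).
Proof.
move=> [f_hom f_ev] [g_hom g_ev]; split=> v /=; last by rewrite f_ev g_ev linearB.
by rewrite linearB /= f_hom g_hom !tmapE -tmap_sub.
Qed.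

Section Cobar.
Variable N : smod.
Local Notation T := (cobar_mod N).
Local Notation d := (cobar_diff N).

Lemma cobar_hom i : is_even_hom (d i).
Proof.
elim: i => [|i ih]; first exact: coact_hom.
by apply: sub_hom; [exact: coact_hom|exact: (tmap_hom ih.2)].
Qed.

Lemma cobar_diffS i (x : T i.+1) : d i.+1 x = coact (T i.+1) x - tmap (d i) x.
Proof. by []. Qed.

(** Since the differential is a homomorphism, its square at one stage reduces to [tmap] of the
    square at the stage before. *)
Lemma cobar_diff_diff i x : d i.+1 (d i x) = 0.
Proof.
elim: i x => [|i ih] x; first by rewrite cobar_diffS [X in X - _](coact_hom N).1 subrr.
rewrite cobar_diffS [X in X - _](cobar_hom i.+1).1 tmapE -linearB.
rewrite (_ : coact (T i.+1) x - d i.+1 x = tmap (d i) x); last first.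
  by rewrite cobar_diffS opprB addrC subrK.
rewrite [LHS]tmap_tmap.
by rewrite /tlift /tsum big1 // => p _; rewrite ih tpure0l.
Qed.

(** A contracting homotopy, linear but not equivariant: [contr] splits the coaction and is natural
    with respect to [tmap]. *)
Lemma cobar_contr i (x : T i.+1) : contr (d i.+1 x) + d i (contr x) = x.
Proof.
have -> : contr (d i.+1 x) = x - d i (contr x); last by rewrite subrK.
transitivity (contr (V := T i.+1) (coact (T i.+1) x) - contr (V := T i.+1) (tmap (d i) x)).
  exact: (linearB (@contr (T i.+1))).
by rewrite contr_coact contr_tmap.
Qed.

Lemma cobar_exact0 (x : T 1) : d 1 x = 0 <-> exists v, x = d 0 v.
Proof.
split=> [dx|[v ->]]; last exact: cobar_diff_diff.
by exists (contr x); rewrite -[LHS]cobar_contr dx linear0 add0r.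
Qed.

Lemma cobar_exactS i (x : T i.+2) : d i.+2 x = 0 <-> exists y, x = d i.+1 y.
Proof.
split=> [dx|[v ->]]; last exact: cobar_diff_diff.
by exists (contr x); rewrite -[LHS]cobar_contr dx linear0 add0r.
Qed.

(** Degree [i] is [T i.+1] because [T 0] is [N] itself; the coaction [d 0] is the augmentation. *)
Definition cobar_resolution : injective_resolution N :=
  @InjectiveResolution k m n N (fun i => T i.+1) (d 0) (fun i => d i.+1)
    (fun i => @cofree_injective (T i)) (cobar_hom 0) (fun i => cobar_hom i.+1)
    (can_inj (@contr_coact N)) cobar_exact0 cobar_exactS.

Local Notation one := (1 : C).

Lemma comul1 : comul one = one \tp one.
Proof. by rewrite /comul rmorph1. Qed.

Lemma cofree_coact_one (V : superspace k) (v : V) :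
  cofree_coact (v \tp one) = (v \tp one) \tp one.
Proof. by rewrite cofree_coact_pure comul1 tassoc_pure. Qed.

Lemma contr_one (V : superspace k) (v : V) : contr (v \tp one) = v.
Proof. by rewrite contr_pure /counit rmorph1 scale1r. Qed.

(** The invariants of [T i.+1] are the elements [u \tp one], so the complex computing Ext has terms
    [T i] and differential [u \tp one - d i u]. *)
Lemma cobar_diff_one i (u : T i) : d i.+1 (u \tp one) = (u \tp one - d i u : T i.+1) \tp one.
Proof.
rewrite cobar_diffS -[coact _ _]/(cofree_coact _) cofree_coact_one tmap_pure.
by rewrite tpureDl -[- d i u]scaleN1r tpureZl scaleN1r.
Qed.

Lemma Ext_neq0_cobar i (w : T i.+1) : d i.+1 w = w \tp one ->
  (forall u : T i, w <> u \tp one - d i u) -> Ext_neq0 i.+1 (triv k m n) N.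
Proof.
move=> dw nw; pose K := triv k m n.
have coactK (U : superspace k) (g : {linear K -> U}) v :
    tlift (fun a (c : C) => g a \tp c) (coact K v) = g v \tp one.
  exact: (tmap_pure (V := K) g v one).
have f_lin : linear (fun a : K => (a : k) *: (w \tp one) : cofree m n (T i.+1)).
  by move=> a x y; rewrite scalerDl scalerA.
pose f : {linear K -> cofree m n (T i.+1)} := linear_of f_lin.
have fE a : f a = (a : k) *: (w \tp one) by [].
exists cobar_resolution, f; split; first split=> v.
- rewrite [RHS]coactK fE [RHS]tpureZl -cofree_coact_one.
  exact: (linearZ_LR (coact (cofree m n (T i.+1)))).
- rewrite fE; etransitivity; first exact: (linearZ_LR (d i.+2)).
  have -> : d i.+2 (w \tp one) = 0; last exact: scaler0.
  by rewrite cobar_diff_one -dw subrr tpure0l.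
case=> h [h_hom hd].
(* [h] sends 1 to an invariant, and [tmap_contr] recovers an element of a cofree supermodule from
   its coaction. *)
have h1 : h (1 : k) = contr (h (1 : k)) \tp one.
  have e : cofree_coact (V := T i) (h (1 : k)) = h (1 : k) \tp one.
    exact: (etrans (h_hom (1 : k)) (coactK _ h _)).
  by rewrite -[LHS](tmap_contr (V := T i)) e tmap_pure.
apply: (nw (contr (h (1 : k)))).
have := hd (1 : k); rewrite fE scale1r h1 [X in _ = X]cobar_diff_one.
by move=> /(congr1 (@contr (T i.+1))); rewrite !contr_one.
Qed.
End Cobar.

End Resolution.

(** * Degree two cocycles as functions of two points *)

Section Degree2.
Variables (k : fieldType) (m n : nat).
Local Notation C := (coordGL k m n).
Local Notation K := (triv k m n).
Local Notation one := (1 : C).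
Local Notation T := (cobar_mod K).
Local Notation d := (cobar_diff K).
Local Notation oneK := ((1 : k) : K).

(** The stages of the cobar complex are bracketed to the left and begin with the coefficient module,
    hence the rebracketing and the inserted [oneK]. *)
Definition triple (x : tens C (tens C C)) : T 3 :=
  tlift (fun (c : C) (t : tens C C) => tassoc (V := T 1) (oneK \tp c) t) x.

Lemma triple_bilin : bilin (fun (c : C) (t : tens C C) => tassoc (V := T 1) (oneK \tp c) t).
Proof.
split=> [c|t] a x y; first exact: linearP.
apply: (@tlift_param _ _ _ C _ (fun v c c' => ((oneK \tp v) \tp c) \tp c')) => c c' {}a {}x {}y.
by rewrite tpure_linearr !tpure_linearl.
Qed.

Lemma triple_linear : linear triple.
Proof. exact: (tlift_linear triple_bilin). Qed.
HB.instance Definition _ := GRing.isLinear.Build k _ (T 3) _ triple triple_linear.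

Lemma triple_pure (c : C) (t : tens C C) : triple (c \tp t) = tassoc (V := T 1) (oneK \tp c) t.
Proof. exact: (tlift_pure _ _ triple_bilin). Qed.

Local Notation g1 := (gen1 k m n).
Local Notation g2 := (gen2 k m n).
Local Notation g3 := (gen3 k m n).
Local Notation incl := (@tassoc k m n K oneK).

Lemma triple_eval_linear (A := tens_csalg (tone_neq0 C (tens_csalg (tone_neq0 C C))))
  (g h : GLpt m n A) : linear (fun t => triple (eval2 g h t) : T 3).
Proof. by move=> a x y; rewrite eval2_linear; apply: triple_linear. Qed.

(** This lemma and the next three match F(g, h), F(g, hl), F(gh, l) and F(h, l), at the universal
    triple, with the four cofaces in the complex of invariants. *)
Lemma triple12 F : triple (eval2 g1 g2 F) = incl F \tp one.
Proof.
have hl : linear (fun t => incl t \tp one : T 3).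
  by move=> a x y; rewrite linearP tpure_linearl.
apply: (tens_linear_ext (f := linear_of (triple_eval_linear g1 g2))
  (g := linear_of hl)) => c c' /=.
rewrite eval2_pure tassoc_pure.
have -> : ceval g1 c * ceval g2 c' = ceval g1 c * eval2 g2 g3 (c' \tp one).
  by rewrite eval2_pure rmorph1 mulr1.
by rewrite eval_gen1_23 triple_pure tassoc_pure.
Qed.

Lemma triple1_23 F : triple (eval2 g1 (GLmul g2 g3) F) = cofree_coact (V := T 1) (incl F).
Proof.
apply: (tens_linear_ext (f := linear_of (triple_eval_linear g1 (GLmul g2 g3)))
  (g := cofree_coact (V := T 1) \o incl)) => c c' /=.
by rewrite eval2_pure -eval2_comul eval_gen1_23 triple_pure tassoc_pure cofree_coact_pure.
Qed.

Lemma triple12_3 F : triple (eval2 (GLmul g1 g2) g3 F) = tmap (V := T 1) (W := T 2) (coact (T 1)) (incl F).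
Proof.
apply: (tens_linear_ext (f := linear_of (triple_eval_linear (GLmul g1 g2) g3))
  (g := tmap (V := T 1) (W := T 2) (coact (T 1)) \o incl)) => c c' /=.
rewrite tassoc_pure tmap_pure /= cofree_coact_pure.
rewrite eval2_pure -eval2_comul eval_gen12_3 -[RHS]/(tpure _ _).
rewrite /tassoc tpure_tlift (linear_tlift (linear_of triple_linear)).
apply: eq_tlift => e e' /=.
by rewrite triple_pure tassoc_pure.
Qed.

Lemma triple23 F : triple (eval2 g2 g3 F)
  = tmap (V := T 1) (W := T 2) (tmap (V := T 0) (W := T 1) (d 0)) (incl F).
Proof.
apply: (tens_linear_ext (f := linear_of (triple_eval_linear g2 g3))
  (g := tmap (V := T 1) (W := T 2) (tmap (V := T 0) (W := T 1) (d 0)) \o incl)) => c c' /=.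
rewrite tassoc_pure !tmap_pure /= tmap_pure.
have -> : eval2 g2 g3 (c \tp c') = one \tp (c \tp c').
  by rewrite -[RHS]eval_gen1_23 rmorph1 mul1r.
by rewrite triple_pure tassoc_pure.
Qed.
Lemma incl_cocycle F :
  eval2 g2 g3 F - eval2 (GLmul g1 g2) g3 F + eval2 g1 (GLmul g2 g3) F - eval2 g1 g2 F = 0 ->
  d 2 (incl F) = incl F \tp one.
Proof.
move=> /(congr1 triple); rewrite linear0 linearB linearD linearB /=.
rewrite triple12 triple1_23 triple12_3 triple23 => E.
have dE : d 2 (incl F) = cofree_coact (V := T 1) (incl F)
   - (tmap (V := T 1) (W := T 2) (coact (T 1)) (incl F)
      - tmap (V := T 1) (W := T 2) (tmap (V := T 0) (W := T 1) (d 0)) (incl F)).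
  by rewrite -tmap_sub.
move/subr0_eq: E => <-; rewrite [LHS]dE opprB; exact: addrC.
Qed.

Definition scaleK (x : T 1) : csalg_superspace C := tlift (fun (a : K) (c : C) => (a : k) *: c) x.

Lemma scaleK_bilin : bilin (fun (a : K) (c : C) => (a : k) *: c).
Proof.
split=> [a|c] s x y; last by rewrite scalerDl scalerA.
by rewrite scalerDr !scalerA mulrC.
Qed.

Lemma scaleK_linear : linear scaleK.
Proof. exact: (tlift_linear scaleK_bilin). Qed.
HB.instance Definition _ :=
  GRing.isLinear.Build k (T 1) (csalg_superspace C) _ scaleK scaleK_linear.

Lemma scaleK_pure (a : K) (c : C) : scaleK (a \tp c) = (a : k) *: c.
Proof. exact: (tlift_pure _ _ scaleK_bilin). Qed.

Lemma scaleK_tassoc (a : K) t : tmap scaleK (tassoc a t) = (a : k) *: t.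
Proof.
rewrite /tassoc tmap_tlift -[t in RHS]tlift_tpure.
transitivity (tlift (fun c c' : C => (a : k) *: (c \tp c')) t).
  by apply: eq_tlift => c c'; rewrite tmap_pure /= scaleK_pure tpureZl.
by rewrite /tlift /tsum scaler_sumr.
Qed.

Lemma scaleK_diff u : tmap scaleK (d 1 u) = comul (scaleK u) - one \tp scaleK u.
Proof.
have hl : linear (fun u => comul (scaleK u) - one \tp scaleK u).
  by move=> a x y; rewrite scaleK_linear comul_linear tpure_linearr scalerBr opprD addrACA.
apply: (tens_linear_ext (f := tmap scaleK \o d 1) (g := linear_of hl)) => a c /=.
rewrite cofree_coact_pure tmap_pure linearB /= scaleK_tassoc tmap_pure /= scaleK_pure.
rewrite scaleK_pure; have -> : comul ((a : k) *: c) = (a : k) *: comul c.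
  exact: (linearZ_LR (linear_of (@comul_linear k m n))).
by rewrite tpureZl tpureZr.
Qed.

(** In terms of functions on points, the excluded form of [F] is c(g) - c(gh) + c(h). *)
Lemma Ext2_neq0 F :
  eval2 g2 g3 F - eval2 (GLmul g1 g2) g3 F + eval2 g1 (GLmul g2 g3) F - eval2 g1 g2 F = 0 ->
  (forall c : C, F <> c \tp one - comul c + one \tp c) -> Ext_neq0 2 K K.
Proof.
move=> /incl_cocycle dF nF; apply: (Ext_neq0_cobar dF) => u /(congr1 (tmap scaleK)).
rewrite scaleK_tassoc scale1r linearB /= scaleK_diff tmap_pure opprB /= => E.
by apply: (nF (scaleK u)); rewrite E addrA addrAC.
Qed.
End Degree2.

(** * Restriction to the queer subgroup *)

Section Exterior.
Variables (k : fieldType) (L : comAlgType k).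

(* The exterior algebra on two odd generators [s] and [s'], with coordinates
   along [1], [s], [s'] and [s s']. *)
Record exterior2 := Exterior { x0 : L; x1 : L; x2 : L; x12 : L }.
HB.instance Definition _ := gen_eqMixin exterior2.
HB.instance Definition _ := gen_choiceMixin exterior2.

Definition ezero := Exterior 0 0 0 0.
Definition eadd u v := Exterior (x0 u + x0 v) (x1 u + x1 v) (x2 u + x2 v) (x12 u + x12 v).
Definition eopp u := Exterior (- x0 u) (- x1 u) (- x2 u) (- x12 u).
Definition escale (s : k) u := Exterior (s *: x0 u) (s *: x1 u) (s *: x2 u) (s *: x12 u).
Definition eone := Exterior 1 0 0 0.
Definition emul u v := Exterior (x0 u * x0 v) (x0 u * x1 v + x1 u * x0 v)
  (x0 u * x2 v + x2 u * x0 v) (x0 u * x12 v + x12 u * x0 v + x1 u * x2 v - x2 u * x1 v).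

Lemma exteriorP u v : x0 u = x0 v -> x1 u = x1 v -> x2 u = x2 v -> x12 u = x12 v -> u = v.
Proof. by case: u v => [a b c d] [a' b' c' d'] /= -> -> -> ->. Qed.

Lemma eaddA : associative eadd.
Proof. by move=> u v w; apply: exteriorP; apply: addrA. Qed.
Lemma eaddC : commutative eadd.
Proof. by move=> u v; apply: exteriorP; apply: addrC. Qed.
Lemma eadd0 : left_id ezero eadd.
Proof. by move=> u; apply: exteriorP; apply: add0r. Qed.
Lemma eaddN : left_inverse ezero eopp eadd.
Proof. by move=> u; apply: exteriorP; apply: addNr. Qed.
HB.instance Definition _ := GRing.isZmodule.Build exterior2 eaddA eaddC eadd0 eaddN.

Lemma escaleA a b u : escale a (escale b u) = escale (a * b) u.
Proof. by apply: exteriorP; apply: scalerA. Qed.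
Lemma escale1 : left_id 1 escale.
Proof. by move=> u; apply: exteriorP; apply: scale1r. Qed.
Lemma escaleDr : right_distributive escale +%R.
Proof. by move=> a u v; apply: exteriorP; apply: scalerDr. Qed.
Lemma escaleDl u : {morph escale^~ u : a b / a + b}.
Proof. by move=> a b; apply: exteriorP; apply: scalerDl. Qed.
HB.instance Definition _ :=
  GRing.Zmodule_isLmodule.Build k exterior2 escaleA escale1 escaleDr escaleDl.

Lemma emulA : associative emul.
Proof. by move=> u v w; apply: exteriorP => /=; ring. Qed.
Lemma emul1l : left_id eone emul.
Proof. by move=> u; apply: exteriorP => /=; ring. Qed.
Lemma emul1r : right_id eone emul.
Proof. by move=> u; apply: exteriorP => /=; ring. Qed.
Lemma emulDl : left_distributive emul +%R.
Proof. by move=> u v w; apply: exteriorP => /=; ring. Qed.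
Lemma emulDr : right_distributive emul +%R.
Proof. by move=> u v w; apply: exteriorP => /=; ring. Qed.
Lemma eone_neq0 : eone != 0.
Proof. by apply/eqP => /(congr1 x0) /eqP; rewrite oner_eq0. Qed.
HB.instance Definition _ := GRing.Zmodule_isNzRing.Build exterior2
  emulA emul1l emul1r emulDl emulDr eone_neq0.

Lemma escaleAl s (u v : exterior2) : s *: (u * v) = (s *: u) * v.
Proof.
by apply: exteriorP; rewrite /= -!scalerAl ?scalerBr ?scalerDr.
Qed.
Lemma escaleAr s (u v : exterior2) : s *: (u * v) = u * (s *: v).
Proof.
by apply: exteriorP; rewrite /= -!scalerAr ?scalerBr ?scalerDr.
Qed.
HB.instance Definition _ := GRing.Lmodule_isLalgebra.Build k exterior2 escaleAl.
HB.instance Definition _ := GRing.Lalgebra_isAlgebra.Build k exterior2 escaleAr.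

Definition eeven (u : exterior2) := Exterior (x0 u) 0 0 (x12 u).
Lemma eeven_linear : linear eeven.
Proof. by move=> s u v; apply: exteriorP; rewrite //= scaler0 addr0. Qed.
HB.instance Definition _ := GRing.isLinear.Build k exterior2 exterior2 _ eeven eeven_linear.

Lemma eevenK u : eeven (eeven u) = eeven u. Proof. by []. Qed.
Lemma eeven1 : homog eeven false 1. Proof. by []. Qed.

Lemma homog_eeven b (u : exterior2) : homog eeven b u ->
  u = if b then Exterior 0 (x1 u) (x2 u) 0 else Exterior (x0 u) 0 0 (x12 u).
Proof.
by case: b => h; apply: exteriorP => //=;
  [exact: (congr1 x0 h)|exact: (congr1 x12 h)
  |exact: (esym (congr1 x1 h))|exact: (esym (congr1 x2 h))].
Qed.

Lemma eevenM b c u v : homog eeven b u -> homog eeven c v -> homog eeven (b (+) c) (u * v).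
Proof.
move=> /homog_eeven -> /homog_eeven ->; case: b c => [] [];
  by apply: exteriorP; rewrite /homog /= ?(mul0r, mulr0, add0r, addr0, subr0, oppr0).
Qed.

Lemma eevenC b c u v : homog eeven b u -> homog eeven c v ->
  u * v = (-1) ^+ (b && c) * (v * u).
Proof.
move=> /homog_eeven -> /homog_eeven ->; case: b c => [] [];
  rewrite /= ?expr0 ?expr1 ?mul1r ?mulN1r; apply: exteriorP => /=; ring.
Qed.

Definition exterior_csalg : csalg k := Csalg eevenK eeven1 eevenM eevenC.
End Exterior.

Section PointInduction.
Variables (k : fieldType) (m n : nat) (A : csalg k) (g : GLpt m n A).

Lemma ceval_ind (P : A -> Prop) :
  (forall c : k, P c%:A) -> (forall u v, P u -> P v -> P (u + v)) ->
  (forall u v, P u -> P v -> P (u * v)) ->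
  (forall i j, P (gmx g i j)) -> (forall i j, P (ginv g i j)) ->
  forall x, P (ceval g x).
Proof.
move=> Pc PD PM PX PV x; rewrite /ceval; elim: (repr x) => //= s hs t ht.
  exact: PD.
exact: PM.
Qed.
End PointInduction.

(** * The queer subgroup inside GL(m|n) *)

Section Queer.
Variables (k : fieldType) (m n : nat) (A : csalg k).
Hypotheses (m_gt0 : (0 < m)%N) (n_gt0 : (0 < n)%N).

Definition qi : 'I_(m + n) := lshift n (Ordinal m_gt0).
Definition qj : 'I_(m + n) := rshift m (Ordinal n_gt0).

(** The queer matrix [[a, b], [b, a]] placed on the first even and the first odd index, completed by
    the identity. *)
Definition qmx (a b : A) : 'M[A]_(m + n) := \matrix_(i, j)
  if i == qi then if j == qi then a else if j == qj then b else 0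
  else if i == qj then if j == qi then b else if j == qj then a else 0
  else (i == j)%:R.

Lemma qij : (qi == qj) = false.
Proof. exact: eq_lrshift. Qed.
Lemma qji : (qj == qi) = false.
Proof. exact: eq_rlshift. Qed.

Lemma qmx_row a b i (f : 'I_(m + n) -> A) : \sum_s qmx a b i s * f s =
  if i == qi then a * f qi + b * f qj
  else if i == qj then b * f qi + a * f qj else f i.
Proof.
have two (c d : A) : \sum_s (if s == qi then c else if s == qj then d else 0) * f s
    = c * f qi + d * f qj.
  rewrite (bigD1 qi) // (bigD1 qj) ?qji // !eqxx big1 /= ?addr0 //.
  by move=> s /andP[/negPf -> /negPf ->]; rewrite mul0r.
case: (eqVneq i qi) => [->|ni].
  by rewrite -two; apply: eq_bigr => s _; rewrite mxE eqxx.
case: (eqVneq i qj) => [->|nj].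
  by rewrite -two; apply: eq_bigr => s _; rewrite mxE qji eqxx.
rewrite (bigD1 i) //= big1 ?addr0 => [|s si]; rewrite mxE (negPf ni) (negPf nj).
  by rewrite eqxx mul1r.
by rewrite eq_sym (negPf si) mul0r.
Qed.

Lemma qmxM a b a' b' : qmx a b *m qmx a' b' = qmx (a * a' + b * b') (a * b' + b * a').
Proof.
apply/matrixP => i j; rewrite mxE qmx_row !mxE !eqxx qji.
case: (i == qi); first by case: (j == qi); case: (j == qj); rewrite ?mulr0 ?addr0.
case: (i == qj) => //; case: (j == qi); first exact: addrC.
by case: (j == qj); rewrite ?mulr0 ?addr0 // addrC.
Qed.

Lemma qmx1 : qmx 1 0 = 1%:M.
Proof.
apply/matrixP => i j; rewrite !mxE.
case: (eqVneq i qi) => [->|ni]; first by rewrite eq_sym; case: eqP => // _; rewrite if_same.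
case: (eqVneq i qj) => [->|//]; rewrite [qj == j]eq_sym.
case: (eqVneq j qi) => [->|_]; first by rewrite qij.
by case: (j == qj).
Qed.

Lemma par_qi : par qi = false.
Proof. by rewrite /par /= leqNgt m_gt0. Qed.
Lemma par_qj : par qj = true.
Proof. by rewrite /par /= leq_addr. Qed.

Lemma even_qmx a b : homog (cev A) false a -> homog (cev A) true b -> even_smx (qmx a b).
Proof.
move=> ha hb i j; have h0 c : homog (cev A) c 0 by apply: homog0.
rewrite mxE; case: (eqVneq i qi) => [->|ni].
  case: (eqVneq j qi) => [->|_]; first by rewrite addbb.
  by case: (eqVneq j qj) => [->|_] //; rewrite par_qi par_qj.
case: (eqVneq i qj) => [->|nj].
  case: (eqVneq j qi) => [->|_]; first by rewrite par_qi par_qj.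
  by case: (eqVneq j qj) => [->|_] //; rewrite addbb.
by case: eqP => [->|_] //; rewrite addbb; apply: cev1.
Qed.

Lemma qmx_ind (P : A -> Prop) a b : P 0 -> P 1 -> P a -> P b -> forall i j, P (qmx a b i j).
Proof. by move=> P0 P1 Pa Pb i j; rewrite mxE; do ?[case: ifP => _ //]; case: (i == j). Qed.

Definition qpt a b a' b' (ha : homog (cev A) false a) (hb : homog (cev A) true b)
  (ha' : homog (cev A) false a') (hb' : homog (cev A) true b')
  (e1 : qmx a b *m qmx a' b' = 1%:M) (e2 : qmx a' b' *m qmx a b = 1%:M) : GLpt m n A :=
  GLPt (even_qmx ha hb) (even_qmx ha' hb') e1 e2.
End Queer.

(** * The pair of points that detects the class *)

Section Detection.
Variables (k : fieldType) (p m n : nat).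
Hypotheses (charp : p \in [pchar k]) (p_gt2 : (2 < p)%N) (m_gt0 : (0 < m)%N) (n_gt0 : (0 < n)%N).
Variables (L : comAlgType k) (x xi : L) (D : {linear L -> L}) (l : {linear L -> k^o}).
Hypotheses (xxi : x * xi = 1) (xp : x ^+ p = 1) (D1 : D 1 = 0) (Dx : D x = x).
Hypotheses (DM : forall u v, D (u * v) = u * D v + D u * v).
Hypotheses (lD : forall u, l (D u) = 0) (l1 : l 1 = 1).

Local Notation A := (exterior_csalg L).
Local Notation ext a b c d := (Exterior a b c d : A).

Lemma Dxi : D xi = - xi.
Proof.
have e : x * D xi = - 1.
  by apply/eqP; rewrite -addr_eq0 -[in X in _ + X]xxi -[in X in _ + X * _]Dx -DM xxi D1.
by rewrite -[LHS]mul1r -xxi (mulrC x) -mulrA e mulrN1.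
Qed.

Definition sub_s (z : A) : Prop := x2 z = 0 /\ x12 z = 0.
Definition sub_s' (z : A) : Prop := x1 z = 0 /\ x12 z = 0.
(** Contains the entries of the product point, whose even entry is [x (1 + s s')]. It is closed
    under products by the Leibniz rule, the two odd cross terms cancelling because [x1] and [x2]
    agree. *)
Definition sub_diag (z : A) : Prop := x2 z = x1 z /\ x12 z = D (x0 z).

Definition pt_s : GLpt m n A.
refine (@qpt k m n A m_gt0 n_gt0 (ext x 0 0 0) (ext 0 x 0 0) (ext xi 0 0 0) (ext 0 (- xi) 0 0)
  _ _ _ _ _ _); try by [].
- rewrite qmxM -qmx1; congr qmx; apply: exteriorP => /=; rewrite -?xxi; ring.
- rewrite qmxM -qmx1; congr qmx; apply: exteriorP => /=; rewrite -?xxi; ring.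
Defined.

Definition pt_s' : GLpt m n A.
refine (@qpt k m n A m_gt0 n_gt0 (ext 1 0 0 0) (ext 0 0 1 0) (ext 1 0 0 0) (ext 0 0 (- 1) 0)
  _ _ _ _ _ _); try by [].
- rewrite qmxM -qmx1; congr qmx; apply: exteriorP => /=; ring.
- rewrite qmxM -qmx1; congr qmx; apply: exteriorP => /=; ring.
Defined.

Lemma ceval_s u : sub_s (ceval pt_s u).
Proof.
apply: ceval_ind => [c|v w [h1 h2] [h3 h4]|v w [h1 h2] [h3 h4]|i j|i j].
- by split; rewrite /= scaler0.
- by split; rewrite /= ?h1 ?h2 ?h3 ?h4 addr0.
- by split; rewrite /= ?h1 ?h2 ?h3 ?h4 ?(mul0r, mulr0) ?subr0 ?addr0.
- exact: qmx_ind.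
- exact: qmx_ind.
Qed.

Lemma ceval_s' u : sub_s' (ceval pt_s' u).
Proof.
apply: ceval_ind => [c|v w [h1 h2] [h3 h4]|v w [h1 h2] [h3 h4]|i j|i j].
- by split; rewrite /= scaler0.
- by split; rewrite /= ?h1 ?h2 ?h3 ?h4 addr0.
- by split; rewrite /= ?h1 ?h2 ?h3 ?h4 ?(mul0r, mulr0) ?subr0 ?addr0.
- exact: qmx_ind.
- exact: qmx_ind.
Qed.

Lemma gmx_diag : gmx (GLmul pt_s pt_s') = qmx m_gt0 n_gt0 (ext x 0 0 x) (ext 0 x x 0).
Proof. by rewrite [LHS]qmxM; congr qmx; apply: exteriorP => /=; ring. Qed.

Lemma ginv_diag :
  ginv (GLmul pt_s pt_s') = qmx m_gt0 n_gt0 (ext xi 0 0 (- xi)) (ext 0 (- xi) (- xi) 0).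
Proof. by rewrite [LHS]qmxM; congr qmx; apply: exteriorP => /=; ring. Qed.

Lemma ceval_diag u : sub_diag (ceval (GLmul pt_s pt_s') u).
Proof.
have D0 : D 0 = 0 by apply: linear0.
apply: ceval_ind => [c|v w [h1 h2] [h3 h4]|v w [h1 h2] [h3 h4]|i j|i j].
- by split; rewrite /= ?linearZ /= ?D1.
- by split; rewrite /= ?h1 ?h2 ?h3 ?h4 ?linearD.
- by split; rewrite /= ?h1 ?h2 ?h3 ?h4 // DM; ring.
- by rewrite gmx_diag; apply: qmx_ind; split; rewrite /= ?D0 ?D1 ?Dx.
- by rewrite ginv_diag; apply: qmx_ind; split; rewrite /= ?D0 ?D1 ?Dxi.
Qed.

(** Only the product point contributes an [s s'] coefficient, and that one lies in the image of [D],
    which [l] kills. *)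
Lemma detect_vanish u : l (x12 (ceval pt_s u - ceval (GLmul pt_s pt_s') u + ceval pt_s' u)) = 0.
Proof.
have [_ h1] := ceval_s u; have [_ h2] := ceval_s' u; have [_ h3] := ceval_diag u.
by rewrite /= h1 h2 h3 add0r addr0 linearN /= lD oppr0.
Qed.

Lemma even_proj_exp a j : even_proj (ext a 0 0 0) ^+ j = even_proj (ext (a ^+ j) 0 0 0).
Proof.
elim: j => [|j ih]; first by apply: val_inj.
rewrite exprS ih -even_projM //; congr even_proj.
by rewrite exprS; apply: exteriorP => /=; ring.
Qed.

Lemma frob_qmx a b : a ^+ p = 1 -> frob p (qmx m_gt0 n_gt0 (ext a 0 0 0) b) = 1%:M.
Proof.
move=> ap; have p0 : even_proj (0 : A) ^+ p = 0 by rewrite raddf0 expr0n; case: p p_gt2.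
have p1 : even_proj (1 : A) ^+ p = 1.
  by rewrite (_ : even_proj 1 = 1) ?expr1n //; apply: val_inj.
have pa : even_proj (ext a 0 0 0) ^+ p = 1.
  by rewrite even_proj_exp ap; apply: val_inj.
apply/matrixP => i j; rewrite !mxE !(inj_eq (@lshift_inj m n)) !eq_lrshift.
case: (eqVneq i (Ordinal m_gt0)) => [->|ni]; last by case: eqP.
by rewrite [in RHS]eq_sym; case: (j == Ordinal m_gt0).
Qed.

(** Since [x ^+ p = 1] the Frobenius matrices are the identity, and the trace of [teich] remains.
    Its first diagonal entry has the two summands [x] and [x s s'], handled by [witt_pair]; every
    other diagonal entry has a single nonzero summand. *)
Lemma cocycle_detect : cocycle p pt_s pt_s' = ext 0 0 0 (- 1).
Proof.
rewrite /cocycle (frobM charp p_gt2 (ginv_even pt_s') (ginv_even pt_s)).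
have xip : xi ^+ p = 1 by rewrite -[LHS]mul1r -xp -exprMn xxi expr1n.
rewrite !frob_qmx ?expr1n // !mulmx1 /mxtrace (bigD1 (Ordinal m_gt0)) //= big1 ?addr0; last first.
  move=> i ni; rewrite mxE; apply: (witt_single (even_pchar _ charp) (i := lshift n i)) => t ti.
  rewrite !mxE (inj_eq (@lshift_inj m n)) (negPf ni) eq_lrshift eq_sym (negPf ti).
  by rewrite mul0r raddf0.
pose e := even_proj (ext 0 0 0 1).
rewrite mxE (witt_pair (even_pchar _ charp) (i := qi n m_gt0) (j := qj m n_gt0)
  (a := even_proj (ext x 0 0 0)) (e := e)).
- have -> : even_proj (ext x 0 0 0) ^+ p = 1 by rewrite even_proj_exp xp; apply: val_inj.
  by rewrite mul1r -raddfN; apply: exteriorP => //=; rewrite oppr0.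
- by rewrite qij.
- by rewrite expr2 -even_projM //; apply: val_inj; apply: exteriorP => /=; ring.
- rewrite !mxE /qi !eqxx; congr even_proj; apply: exteriorP => /=; ring.
- rewrite -even_projM // !mxE !eqxx !qji; congr even_proj; apply: exteriorP => /=; ring.
- move=> t ti tj; rewrite !mxE !eqxx (negPf ti) (negPf tj) mul0r; exact: raddf0.
Qed.
End Detection.

(** * The algebra k[X]/(X^p - 1) and its Euler derivation *)

Section CyclicAlgebra.
Variables (k : fieldType) (p : nat).
Hypotheses (charp : p \in [pchar k]) (p_gt2 : (2 < p)%N).
Local Notation h := ('X^p - 1 : {poly k}).
Local Notation L := {poly %/ h}.

Let p_gt0 : (0 < p)%N := ltn_trans (isT : 0 < 2)%N p_gt2.

Lemma cyclic_monic : h \is monic.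
Proof. exact: monicXnsubC. Qed.

(** The quotient is taken by [mk_monic h], which is [h] itself once [h] is known to be monic and
    nonconstant. *)
Lemma mk_monic_cyclic : mk_monic h = h.
Proof. by rewrite /mk_monic cyclic_monic -[1]/(1%:P) size_XnsubC // ltnS p_gt0. Qed.

Lemma in_cyclic_val (u : L) : in_qpoly h (val u) = u.
Proof. by apply/val_inj/in_qpoly_small; apply: size_mk_monic. Qed.

Lemma in_cyclic_mulh q : in_qpoly h (q * h) = 0.
Proof.
rewrite in_qpolyM (_ : in_qpoly h h = 0) ?mulr0 //.
by apply: val_inj; rewrite /= mk_monic_cyclic Pdiv.RingMonic.rmodpp // cyclic_monic.
Qed.

Definition cyclic_x : L := in_qpoly h 'X.
Definition cyclic_xi : L := in_qpoly h 'X^(p.-1).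
(** The derivation X d/dX, which multiplies each power x^j by j. *)
Definition cyclic_D (u : L) : L := in_qpoly h ('X * (val u)^`()).
Definition cyclic_l (u : L) : k^o := (val u)`_0.

Lemma cyclic_xp : cyclic_x ^+ p = 1.
Proof.
transitivity (in_qpoly h (1 * h + 1)).
  by rewrite mul1r subrK -[LHS]rmorphXn.
by rewrite in_qpolyD in_cyclic_mulh add0r in_qpoly1.
Qed.

Lemma cyclic_xxi : cyclic_x * cyclic_xi = 1.
Proof. by rewrite -in_qpolyM -exprS prednK // [LHS]rmorphXn; apply: cyclic_xp. Qed.

Lemma cyclic_D_linear : linear cyclic_D.
Proof.
move=> a u v; rewrite /cyclic_D -in_qpolyZ -in_qpolyD /=.
by rewrite derivD derivZ mulrDr scalerAr.
Qed.
HB.instance Definition _ := GRing.isLinear.Build k L L _ cyclic_D cyclic_D_linear.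

Lemma cyclic_l_linear : linear cyclic_l.
Proof. by move=> a u v; rewrite /cyclic_l /= coefD coefZ. Qed.
HB.instance Definition _ := GRing.isLinear.Build k L k^o _ cyclic_l cyclic_l_linear.

(* Well defined on the quotient because [X^p - 1] has derivative 0. *)
Lemma cyclic_D_in q : cyclic_D (in_qpoly h q) = in_qpoly h ('X * q^`()).
Proof.
have -> : q = Pdiv.Ring.rdivp q h * h + val (in_qpoly h q).
  by rewrite /= mk_monic_cyclic; apply: Pdiv.RingMonic.rdivp_eq cyclic_monic _.
set a := Pdiv.Ring.rdivp q h; rewrite in_qpolyD in_cyclic_mulh add0r in_cyclic_val.
have h' : h^`() = 0.
  by rewrite derivB derivXn derivC subr0 -mulr_natr -polyC_natr (pcharf0 charp) mulr0.
rewrite derivD derivM h' mulr0 addr0 mulrDr in_qpolyD mulrA in_cyclic_mulh add0r.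
by [].
Qed.

Lemma cyclic_DM u v : cyclic_D (u * v) = u * cyclic_D v + cyclic_D u * v.
Proof.
rewrite -[in LHS](in_cyclic_val u) -[in LHS](in_cyclic_val v) -in_qpolyM cyclic_D_in derivM.
transitivity (in_qpoly h (val u) * cyclic_D v + cyclic_D u * in_qpoly h (val v)); last first.
  by rewrite !in_cyclic_val.
rewrite /cyclic_D -!in_qpolyM -in_qpolyD; congr in_qpoly; ring.
Qed.

Lemma cyclic_D1 : cyclic_D 1 = 0.
Proof. by rewrite -(in_qpoly1 h) cyclic_D_in derivC mulr0 in_qpoly0. Qed.

Lemma cyclic_Dx : cyclic_D cyclic_x = cyclic_x.
Proof. by rewrite cyclic_D_in derivX mulr1. Qed.

(** Multiplying the derivative by ['X] does not raise the degree above that of [u], so no reduction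
    takes place and the constant term is visibly 0. *)
Lemma cyclic_lD u : cyclic_l (cyclic_D u) = 0.
Proof.
rewrite /cyclic_l /cyclic_D /= Pdiv.CommonRing.rmodp_small ?coefXM //.
have := size_mk_monic u.
case: (eqVneq (val u) 0) => [->|nz] su; first by rewrite deriv0 mulr0 size_poly0 size_mk_monic_gt0.
apply: leq_ltn_trans (size_polyMleq _ _) _; rewrite size_polyX /=.
exact: leq_ltn_trans (lt_size_deriv nz) su.
Qed.

Lemma cyclic_l1 : cyclic_l 1 = 1.
Proof. by rewrite /cyclic_l /= coef1. Qed.
End CyclicAlgebra.

(** * The universal cocycle and the conclusion *)

Section Universal.
Variables (k : fieldType) (p m n : nat).
Local Notation C := (coordGL k m n).
Local Notation gen := (cgen k m n).
Local Notation nz := (tone_coord_neq0 k m n).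

Definition universal_cocycle : tens C C :=
  cocycle p (GLmap (tinl_shom nz) gen) (GLmap (tinr_shom nz) gen).

Lemma eval_universal_cocycle (A : csalg k) (g h : GLpt m n A) :
  eval2 g h universal_cocycle = cocycle p g h.
Proof.
pose f := copair_shom nz (ceval_shom g) (ceval_shom h).
rewrite -[LHS]/(f universal_cocycle) -cocycle_map /cocycle /=.
have fl x : f (tinl_shom nz x) = ceval g x.
  by rewrite /= [LHS](copair_pure _ (ceval_shom g)) rmorph1 mulr1.
have fr x : f (tinr_shom nz x) = ceval h x.
  by rewrite /= [LHS](copair_pure _ _ (ceval_shom h)) rmorph1 mul1r.
have mapf (M : 'M[C]_(m + n)) : map_mx f (map_mx (tinl_shom nz) M) = map_mx (ceval g) M.
  by apply/matrixP => i j; rewrite !mxE -fl.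
have mapf' (M : 'M[C]_(m + n)) : map_mx f (map_mx (tinr_shom nz) M) = map_mx (ceval h) M.
  by apply/matrixP => i j; rewrite !mxE -fr.
have cXE (l : GLpt m n A) : map_mx (ceval l) (cX k m n) = gmx l.
  by apply/matrixP => i j; rewrite mxE ceval_X.
have cVE (l : GLpt m n A) : map_mx (ceval l) (cV k m n) = ginv l.
  by apply/matrixP => i j; rewrite mxE ceval_V.
by rewrite !mapf !mapf' !cXE !cVE.
Qed.
End Universal.

Local Close Scope ring_scope.

Theorem proposition5p6p1 (k : fieldType) (p m n : nat)
  (kperfect : perfect_field k) (pchark : p \in [pchar k]%R) (p_gt2 : 2 < p)
  (m_gt0 : 0 < m) (n_gt0 : 0 < n) :
  Ext_neq0 2 (triv k m n) (triv k m n).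
Proof.
apply: (@Ext2_neq0 _ _ _ (universal_cocycle k p m n)) => [|c].
  by rewrite !eval_universal_cocycle; apply: cocycleP.
have xxi := cyclic_xxi k p_gt2; have xp := cyclic_xp k p_gt2.
have D1 := cyclic_D1 pchark p_gt2; have Dx := cyclic_Dx pchark p_gt2.
pose g := pt_s m_gt0 n_gt0 xxi.
pose h := pt_s' m_gt0 n_gt0 {poly %/ ('X^p - 1 : {poly k})%R}.
(* At this pair the cocycle is [- s s'], whereas a coboundary c(g) - c(gh) + c(h) has an [s s']
   coefficient with zero constant term. *)
move=> /(congr1 (eval2 g h)); rewrite eval_universal_cocycle (cocycle_detect pchark p_gt2) //.
rewrite linearD linearB /= !eval2_pure eval2_comul !rmorph1 mulr1 mul1r => E.
have := detect_vanish m_gt0 n_gt0 xxi D1 Dx (cyclic_DM pchark p_gt2) (@cyclic_lD k p) c.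
rewrite -E /= (linearN (@cyclic_l k p)) /= cyclic_l1 => /eqP.
by rewrite oppr_eq0 oner_eq0.
Qed.
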